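(* Let $n,r\ge 1$. The big algebra $\mathscr{B}(\mathcal{P}(n,r))$ is generated by the operators $\{F_{p,q}\mid p,q\ge 0,\ p+q\le n\}$, where $$F_{p,q}(Y)=\sum_{\substack{I_1,J_1\in\binom{[n]}{p}\\ I_2,J_2\in\binom{[n]}{q}\\ I_1\sqcup I_2=J_1\sqcup J_2}}\mathrm{sgn}\binom{I_1\ I_2}{J_1\ J_2}\det Y_{I_1J_1}\sum_{R\in\binom{[r]}{q}}\det(X_{J_2,R})\det(D_{I_2,R}).$$ In particular, the operators $M_{p,q}=\mathbf{D}^q(c_{p+q})$ and $F_{p,q}$ ($p,q\ge0$, $p+q\le n$) are related by $$M_{p,q}=\sum_{\ell=0}^{q}(-1)^{q-\ell}(q-\ell)!\,\ell!\,S(q,\ell)\binom{n-p-\ell}{q-\ell}F_{p,\ell},$$ where $S(q,\ell)$ is the Stirling number of the second kind (the number of partitions of a $q$-element set into $\ell$ non-empty subsets).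
   Context: $\mathfrak{gl}_n$ has matrix units $E_{ij}$ and coordinates $y_{ij}$; $c_k(Y)$ is the sum of the principal $k\times k$ minors of $Y$ ($c_0=1$). $\mathcal{P}(n,r)=\mathbb{C}[\mathrm{Mat}(n,r)]=\mathbb{C}[x_{i\alpha}:1\le i\le n,1\le\alpha\le r]$, $\partial_{i\alpha}=\partial/\partial x_{i\alpha}$. $\mathrm{GL}_n$ acts on $\mathcal{P}(n,r)$ by $(gP)(A)=P(g^tA)$ and the corresponding $\mathfrak{gl}_n$-action is $L(E_{ij})=\sum_{\alpha=1}^r x_{i\alpha}\partial_{j\alpha}$. On $\mathrm{GL}_n$-equivariant polynomial maps $F:\mathfrak{gl}_n\to\mathrm{End}\,\mathcal{P}(n,r)$ the Kirillov--Wei operator is $(\mathbf{D}F)(Y)=\sum_{i,j=1}^n\frac{\partial F}{\partial y_{ji}}(Y)\cdot L(E_{ij})$; $c_k$ is identified with $Y\mapsto c_k(Y)\,\mathrm{Id}$. The big algebra $\mathscr{B}(\mathcal{P}(n,r))$ is the subalgebra of the algebra of such maps generated by $M_{p,q}=\mathbf{D}^q(c_{p+q})$, $p,q\ge0$, $p+q\le n$. $X=[x_{i\alpha}]$ and $D=[\partial_{i\alpha}]$ are $n\times r$ matrices, $Y=[y_{ij}]$ is $n\times n$. For a matrix $M$ and tuples $I=(i_1,\dots,i_k)$, $J=(j_1,\dots,j_l)$, $M_{IJ}=[M_{i_aj_b}]$. $[m]=\{1,\dots,m\}$ and $\binom{[m]}{k}$ is the set of $k$-element subsets of $[m]$; subsets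 are used as tuples with an arbitrarily chosen ordering (summands do not depend on the choice). $\mathrm{sgn}\binom{I_1\ I_2}{J_1\ J_2}$ is the sign of the permutation of positions carrying the concatenated tuple $J_1J_2$ to the concatenated tuple $I_1I_2$. *)

(* Defs.v *)
From HB Require Import structures.
From mathcomp Require Import all_boot all_order all_fingroup all_algebra.
From mathcomp Require Import boolp reals complex mpoly.

Set Implicit Arguments.
Unset Strict Implicit.
Unset Printing Implicit Defensive.

Import Order.TTheory GRing.Theory Num.Theory.
Local Open Scope ring_scope.

(* The algebra of all K-linear endomorphisms of K[x_0, .., x_(N-1)], with
   composition as product. *)
Record endo (K : numFieldType) (N : nat) := Endo {
  endo_fun :> {linear {mpoly K[N]} -> {mpoly K[N]}} }.

Section EndoAlgebra.
Context {K : numFieldType} {N : nat}.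
Implicit Types f g h : endo K N.

Lemma endoP f g : (forall p, f p = g p) -> f = g.
Proof.
case: f g => [f] [g] /= eq_fg; congr Endo.
have {eq_fg} : (f : {mpoly K[N]} -> {mpoly K[N]}) = g by apply: funext.
case: f g => [f [[c1] [c2]]] [g [[d1] [d2]]] /= e; move: d1 d2; rewrite -e => d1 d2.
by rewrite (Prop_irrelevance c1 d1) (Prop_irrelevance c2 d2).
Qed.

HB.instance Definition _ := gen_eqMixin (endo K N).
HB.instance Definition _ := gen_choiceMixin (endo K N).

Fact opp_endo_linear f : linear (fun p => - f p).
Proof. by move=> a p q; rewrite linearP opprD scalerN. Qed.
Fact scale_endo_linear (a : K) f : linear (fun p => a *: f p).
Proof. by move=> b p q; rewrite linearP scalerDr !scalerA mulrC. Qed.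

Definition zero_endo : endo K N := Endo \0.
Definition one_endo : endo K N := Endo idfun.
Definition add_endo f g : endo K N := Endo (f \+ g).
Definition opp_endo f : endo K N :=
  Endo (HB.pack (fun p => - f p) (GRing.isLinear.Build _ _ _ _ _ (opp_endo_linear f))).
Definition mul_endo f g : endo K N := Endo (f \o g).
Definition scale_endo (a : K) f : endo K N :=
  Endo (HB.pack (fun p => a *: f p)
    (GRing.isLinear.Build _ _ _ _ _ (scale_endo_linear a f))).

Fact add_endoA : associative add_endo.
Proof. by move=> f g h; apply: endoP => p; rewrite /= addrA. Qed.
Fact add_endoC : commutative add_endo.
Proof. by move=> f g; apply: endoP => p; rewrite /= addrC. Qed.
Fact add_0endo : left_id zero_endo add_endo.
Proof. by move=> f; apply: endoP => p; rewrite /= add0r. Qed.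
Fact add_Nendo : left_inverse zero_endo opp_endo add_endo.
Proof. by move=> f; apply: endoP => p; rewrite /= addNr. Qed.
HB.instance Definition _ := GRing.isZmodule.Build (endo K N)
  add_endoA add_endoC add_0endo add_Nendo.

Fact mul_endoA : associative mul_endo.
Proof. by move=> f g h; apply: endoP. Qed.
Fact mul_1endo : left_id one_endo mul_endo.
Proof. by move=> f; apply: endoP. Qed.
Fact mul_endo1 : right_id one_endo mul_endo.
Proof. by move=> f; apply: endoP. Qed.
Fact mul_endoDl : left_distributive mul_endo +%R.
Proof. by move=> f g h; apply: endoP. Qed.
Fact mul_endoDr : right_distributive mul_endo +%R.
Proof. by move=> f g h; apply: endoP => p; rewrite /= linearD. Qed.
Fact one_endo_neq0 : one_endo != 0.
Proof.
apply/eqP => e; have := oner_neq0 {mpoly K[N]}.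
by rewrite -[X in X != _]/(one_endo 1) e eqxx.
Qed.
HB.instance Definition _ := GRing.Zmodule_isNzRing.Build (endo K N)
  mul_endoA mul_1endo mul_endo1 mul_endoDl mul_endoDr one_endo_neq0.

Fact scale_endoA (a b : K) f : scale_endo a (scale_endo b f) = scale_endo (a * b) f.
Proof. by apply: endoP => p; rewrite /= scalerA. Qed.
Fact scale_1endo : left_id 1 scale_endo.
Proof. by move=> f; apply: endoP => p; rewrite /= scale1r. Qed.
Fact scale_endoDr : right_distributive scale_endo +%R.
Proof. by move=> a f g; apply: endoP => p; rewrite /= scalerDr. Qed.
Fact scale_endoDl f : {morph scale_endo^~ f : a b / a + b}.
Proof. by move=> a b; apply: endoP => p; rewrite /= scalerDl. Qed.
HB.instance Definition _ := GRing.Zmodule_isLmodule.Build K (endo K N)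
  scale_endoA scale_1endo scale_endoDr scale_endoDl.

Fact scale_endoAl (a : K) f g : a *: (f * g) = (a *: f) * g.
Proof. by apply: endoP. Qed.
HB.instance Definition _ := GRing.Lmodule_isLalgebra.Build K (endo K N) scale_endoAl.
Fact scale_endoAr (a : K) f g : a *: (f * g) = f * (a *: g).
Proof. by apply: endoP => p; rewrite /= linearZ. Qed.
HB.instance Definition _ := GRing.Lalgebra_isAlgebra.Build K (endo K N) scale_endoAr.

Fact mulr_endo_linear (q : {mpoly K[N]}) : linear (fun p : {mpoly K[N]} => q * p).
Proof. by move=> a p p'; rewrite mulrDr scalerAr. Qed.
Definition mulop (q : {mpoly K[N]}) : endo K N :=
  Endo (HB.pack (fun p => q * p) (GRing.isLinear.Build _ _ _ _ _ (mulr_endo_linear q))).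

Lemma endoDE f g p : (f + g) p = f p + g p. Proof. by []. Qed.
Lemma endoME f g p : (f * g) p = f (g p). Proof. by []. Qed.
Lemma endo1E p : (1 : endo K N) p = p. Proof. by []. Qed.
Lemma endo0E p : (0 : endo K N) p = 0. Proof. by []. Qed.
Lemma endoZE (a : K) f p : (a *: f) p = a *: f p. Proof. by []. Qed.
Lemma endo_sumE I (s : seq I) (P : pred I) (F : I -> endo K N) p :
  (\sum_(i <- s | P i) F i) p = \sum_(i <- s | P i) F i p.
Proof. by elim/big_rec2: _ => // i y1 y2 _ <-. Qed.

End EndoAlgebra.

(* k-element subsets of [m]; kidx lists one as a tuple, in increasing order. *)
Definition ksub (m k : nat) := {I : {set 'I_m} | #|I| == k}.

Definition kidx m k (I : ksub m k) (a : 'I_k) : 'I_m :=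
  enum_val (cast_ord (esym (eqP (valP I))) a).

Definition catidx m p q (I : ksub m p) (J : ksub m q) (a : 'I_(p + q)) : 'I_m :=
  match split a with inl b => kidx I b | inr c => kidx J c end.

(* The sign of the s with (J1 J2)_a = (I1 I2)_(s a). When I1, I2 are disjoint,
   J1, J2 are disjoint and the unions agree, s exists and is unique. *)
Definition sgn_idx m p q (I1 : ksub m p) (I2 : ksub m q)
    (J1 : ksub m p) (J2 : ksub m q) : int :=
  if [pick s : 'S_(p + q) | [forall a, catidx I1 I2 (s a) == catidx J1 J2 a]]
  is Some s then (-1) ^+ s else 0.

Definition princ_minors (S : pzRingType) (n k : nat) (Z : 'M[S]_n) : S :=
  \sum_(I : ksub n k) \det (mxsub (kidx I) (kidx I) Z).

Definition stirling2 (q l : nat) : nat :=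
  #|[set P : {set {set 'I_q}} | partition P [set: 'I_q] & #|P| == l]|.

Section BigAlgebra.
Context (K : numFieldType) (n r : nat).

Notation P := {mpoly K[n * r]}.
Notation EndP := (endo K (n * r)).

(* Polynomial maps gl_n -> End P, as polynomials in the coordinates y_ij (the
   variable of index mxvec_index i j) with coefficients in End P: the y_ij are
   central, and the product is (F * G)(Y) = F(Y) \o G(Y). *)
Definition polymap : Type := {mpoly EndP[n * n]}.
HB.instance Definition _ := GRing.Lalgebra.on polymap.

Definition varX : 'M[P]_(n, r) := \matrix_(i, a) 'X_(mxvec_index i a).

Definition opX : 'M[EndP]_(n, r) := map_mx mulop varX.
Definition opD : 'M[EndP]_(n, r) :=
  \matrix_(i, a) Endo (mderiv (mxvec_index i a)).

Definition actL (i j : 'I_n) : EndP := \sum_(a < r) opX i a * opD j a.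

(* (g P)(A) = P(g^t A): each x_ia is replaced by the entry (i, a) of g^t X. *)
Definition actGL (g : 'M[K]_n) : EndP :=
  Endo (comp_mpoly
    [tuple mxvec (map_mx (@mpolyC (n * r) K) g^T *m varX) 0 k | k < n * r]).

Definition cst (T : EndP) : polymap := @mpolyC (n * n) EndP T.

Definition varY : 'M[polymap]_n := \matrix_(i, j) 'X_(mxvec_index i j).

Definition scalmx (g : 'M[K]_n) : 'M[polymap]_n := map_mx (fun c : K => cst c%:A) g.

(* F(Z), for a matrix Z with entries commuting with every polynomial map. *)
Definition subY (Z : 'M[polymap]_n) (F : polymap) : polymap :=
  mmap (@mpolyC (n * n) EndP) (mxvec Z 0) F.

(* F(g Y g^-1) = g F(Y) g^-1, as an identity in the coordinates of Y. *)
Definition equivariant (F : polymap) : Prop :=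
  forall g : 'M[K]_n, g \in unitmx ->
    subY (scalmx g *m varY *m scalmx (invmx g)) F
    = cst (actGL g) * F * cst (actGL (invmx g)).

Definition KWop (F : polymap) : polymap :=
  \sum_(i < n) \sum_(j < n) mderiv (mxvec_index j i) F * cst (actL i j).

Definition ck (k : nat) : polymap := princ_minors k varY.

Definition Fpq (p q : nat) : polymap :=
  \sum_(I1 : ksub n p) \sum_(J1 : ksub n p)
  \sum_(I2 : ksub n q) \sum_(J2 : ksub n q
     | [&& [disjoint val I1 & val I2], [disjoint val J1 & val J2]
         & val I1 :|: val I2 == val J1 :|: val J2])
    (\det (mxsub (kidx I1) (kidx J1) varY)
     * cst (\sum_(R : ksub r q) \det (mxsub (kidx J2) (kidx R) opX)
                              * \det (mxsub (kidx I2) (kidx R) opD)))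
    *~ sgn_idx I1 I2 J1 J2.

(* The unital K-subalgebra generated by G. *)
Inductive subalg_gen (G : polymap -> Prop) : polymap -> Prop :=
| gen_in F of G F : subalg_gen G F
| gen_scal (c : K) : subalg_gen G (cst c%:A)
| gen_add F1 F2 of subalg_gen G F1 & subalg_gen G F2 : subalg_gen G (F1 + F2)
| gen_mul F1 F2 of subalg_gen G F1 & subalg_gen G F2 : subalg_gen G (F1 * F2).

End BigAlgebra.

Section MmapCentral.
Context (n k : nat) (R : nzRingType) (Z : 'I_n -> {mpoly R[k]}).
Context (Zc : forall i x, GRing.comm x (Z i)).

Let mmap1_comm m x : GRing.comm x (mmap1 Z m).
Proof. by rewrite /mmap1; apply: commr_prod => i _; apply: commrX. Qed.

Lemma mmap_central_mult : multiplicative (mmap (@mpolyC k R) Z).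
Proof. by apply: commr_mmap_is_multiplicative => // *; apply: mmap1_comm. Qed.

Lemma mmap_centralM p q : mmap (@mpolyC k R) Z (p * q)
  = mmap (@mpolyC k R) Z p * mmap (@mpolyC k R) Z q.
Proof. exact: (mmap_central_mult.1). Qed.

Lemma mderiv_mmap (i : 'I_k) (p : {mpoly R[n]}) :
  (forall l x, GRing.comm x (mderiv i (Z l))) ->
  mderiv i (mmap (@mpolyC k R) Z p)
  = \sum_l mmap (@mpolyC k R) Z (mderiv l p) * mderiv i (Z l).
Proof.
move=> dZc; pose S := mmap (@mpolyC k R) Z.
pose Q p := mderiv i (S p) = \sum_l S (mderiv l p) * mderiv i (Z l).
have QC c : Q c%:MP.
  rewrite /Q /S mmapC mderivC big1 // => l _.
  by rewrite mderivC mmap0 mul0r.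
have QM p1 p2 : Q p1 -> Q p2 -> Q (p1 * p2).
  rewrite /Q => q1 q2; rewrite /S mmap_centralM mderivM -/(S p1) -/(S p2) q1 q2.
  rewrite mulr_suml mulr_sumr -big_split; apply: eq_bigr => l _ /=.
  rewrite mderivM mmapD !mmap_centralM mulrDl -!/(S _); congr (_ + _).
    by rewrite -!mulrA; congr (_ * _); rewrite dZc.
  by rewrite mulrA.
have QX j : Q 'X_j.
  rewrite /Q /S mmapX mmap1U (bigD1 j) //= mderivX mnm1E eqxx scale1r (_ : (U_(j) - U_(j))%MM = 0%MM) ; last by apply/mnmP => l; rewrite mnmBE subnn mnm0E.
  rewrite mpolyX0 -mpolyC1 mmapC mul1r big1 ?addr0 // => l ne.
  by rewrite mderivX mnm1E eq_sym (negPf ne) scale0r mmap0 mul0r.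
have QXm m : Q 'X_[m].
  rewrite mpolyXE_id; apply: (big_ind Q) => [|//|j _].
    by rewrite -mpolyC1.
  elim: (m j) => [|e IH]; first by rewrite expr0 -mpolyC1.
  by rewrite exprS; apply: QM.
rewrite -/(S p) -/(Q p); elim/mpolyind: p => [|c m p _ _ IH].
  by rewrite -mpolyC0.
rewrite /Q /S mmapD mderivD -!/(S _) IH -mul_mpolyC (QM _ _ (QC c) (QXm m)).
by rewrite -big_split; apply: eq_bigr => l _; rewrite mderivD mmapD mulrDl.
Qed.
End MmapCentral.

Lemma mxvecsum (V : nmodType) m n (F : 'I_(m * n) -> V) :
  \sum_k F k = \sum_i \sum_j F (mxvec_index i j).
Proof.
rewrite (reindex _ (curry_mxvec_bij _ _)) /= pair_bigA.
by apply: eq_bigr => [[i j]].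
Qed.

Lemma kidx_inj m k (I : ksub m k) : injective (kidx I).
Proof. by move=> a b /enum_val_inj /cast_ord_inj. Qed.

Lemma kidx_imset m k (I : ksub m k) : [set kidx I a | a : 'I_k] = val I.
Proof.
apply/eqP; rewrite eqEcard card_imset ?card_ord ?(eqP (valP I)) ?leqnn ?andbT.
  by apply/subsetP => _ /imsetP[a _ ->]; rewrite enum_valP.
exact: kidx_inj.
Qed.

Section PrincMinors.
Context (S : comPzRingType) (n : nat).

Let pm (k : nat) (Z : 'M[S]_n) : S :=
  \sum_(f : {ffun 'I_k -> 'I_n}) \det (mxsub f f Z).

Let pmC k (A B : 'M[S]_n) : pm k (A *m B) = pm k (B *m A).
Proof.
have E (C D : 'M[S]_n) : pm k (C *m D) = \sum_(s : 'S_k) (-1) ^+ s *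
    \sum_(f : {ffun 'I_k -> 'I_n}) \sum_(h : {ffun 'I_k -> 'I_n})
    ((\prod_a C (f a) (h a)) * \prod_a D (h a) (f (s a))).
  rewrite /pm exchange_big /=; apply: eq_bigr => s _.
  rewrite mulr_sumr; apply: eq_bigr => f _; congr (_ * _).
  under eq_bigr do rewrite !mxE.
  rewrite bigA_distr_bigA /=; apply: eq_bigr => h _; exact: big_split.
rewrite !E; apply: eq_bigr => s _; congr (_ * _).
rewrite [RHS]exchange_big /=.
rewrite (reindex (fun f : {ffun 'I_k -> 'I_n} => [ffun a => f (s^-1 a)%g])) /=; last first.
  exists (fun f : {ffun 'I_k -> 'I_n} => [ffun a => f (s a)]) => f _;
    by apply/ffunP => a; rewrite !ffunE ?permK ?permKV.
apply: eq_bigr => f _; apply: eq_bigr => h _; rewrite mulrC; congr (_ * _).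
  by apply: eq_bigr => a _; rewrite ffunE permK.
rewrite (reindex_inj (@perm_inj _ s)); apply: eq_bigr => a _ /=.
by rewrite ffunE permK.
Qed.

Let pmE k (Z : 'M[S]_n) : pm k Z = princ_minors k Z *+ k`!.
Proof.
pose h (x : ksub n k * 'S_k) := [ffun a => kidx x.1 (x.2 a)].
have h_inj : injective h.
  move=> [I s] [J t] /ffunP eqh.
  have eIJ : I = J.
    apply: val_inj; rewrite -!kidx_imset; apply/setP => i; apply/imsetP/imsetP => -[a _ ->].
      by exists (t (s^-1 a)%g) => //; have := eqh (s^-1 a)%g; rewrite !ffunE /= permKV.
    by exists (s (t^-1 a)%g) => //; have := eqh (t^-1 a)%g; rewrite !ffunE /= permKV.
  rewrite -eIJ in eqh *; congr (_, _); apply/permP => a.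
  by have := eqh a; rewrite !ffunE => /kidx_inj.
have hT : h @: setT = [set f : {ffun 'I_k -> 'I_n} | injectiveb f].
  apply/eqP; rewrite eqEcard; apply/andP; split.
    apply/subsetP => _ /imsetP[x _ ->]; rewrite inE; apply/injectiveP => a b.
    by rewrite !ffunE => /kidx_inj /perm_inj.
  rewrite card_imset // cardsT card_prod card_inj_ffuns !card_ord card_Sn.
  have := card_draws 'I_n k; rewrite card_ord => cks.
  rewrite card_sig -bin_ffact -cks; apply: eq_leq.
  by congr (_ * _)%N; apply: eq_card => I; rewrite !inE.
rewrite /pm (bigID (fun f : {ffun 'I_k -> 'I_n} => injectiveb f)) /=.
rewrite [X in _ + X]big1 ?addr0 => [|f /injectivePn[a [b ab fab]]]; last first.
  by apply: (determinant_alternate ab) => c; rewrite !mxE fab.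
rewrite (eq_bigl (fun f => f \in h @: setT)) => [|f]; last by rewrite hT inE.
rewrite big_imset /= => [|x y _ _]; last exact: h_inj.
rewrite (eq_bigl xpredT) => [|x]; last by rewrite inE.
rewrite -(pair_bigA _ (fun I s => \det (mxsub (h (I, s)) (h (I, s)) Z))) /=.
rewrite -sumrMnl; apply: eq_bigr => I _.
rewrite -card_Sn -sumr_const; apply: eq_bigr => s _.
pose M := mxsub (kidx I) (kidx I) Z.
have -> : mxsub (h (I, s)) (h (I, s)) Z = row_perm s (col_perm s M).
  by apply/matrixP => a b; rewrite !mxE !ffunE.
by rewrite row_permE col_permE !det_mulmx !det_perm ?odd_permV mulrC -mulrA -signr_addb addbb mulr1.
Qed.

Lemma princ_minorsC k (A B : 'M[S]_n) : GRing.rreg (k`!%:R : S) ->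
  princ_minors k (A *m B) = princ_minors k (B *m A).
Proof.
by move=> reg; apply: reg; rewrite !mulr_natr -!pmE pmC.
Qed.
End PrincMinors.

Lemma comp_mpoly_comp (R : comNzRingType) (a b c : nat) (lp : a.-tuple {mpoly R[b]})
    (lq : b.-tuple {mpoly R[c]}) (p : {mpoly R[a]}) :
  comp_mpoly lq (comp_mpoly lp p) = comp_mpoly [tuple comp_mpoly lq (tnth lp i) | i < a] p.
Proof.
elim/mpolyind: p => [|e m p _ _ IH]; first by rewrite !comp_mpoly0.
rewrite !comp_mpolyD IH !comp_mpolyZ; congr (_ *: _ + _).
rewrite !comp_mpolyX rmorph_prod; apply: eq_bigr => i _ /=.
by rewrite rmorphXn tnth_mktuple.
Qed.

Lemma mderiv_comp_mx (R : comNzRingType) (a b k : nat) (M : 'M[{mpoly R[k]}]_(a, b))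
    (i : 'I_k) (p : {mpoly R[a * b]}) :
  let Mt := [tuple mxvec M 0 l | l < a * b] in
  mderiv i (comp_mpoly Mt p) = \sum_c \sum_d
    comp_mpoly Mt (mderiv (mxvec_index c d) p) * mderiv i (M c d).
Proof.
move=> Mt; rewrite [LHS]mderiv_mmap => [|*|*]; [|exact: mulrC|exact: mulrC].
rewrite mxvecsum; apply: eq_bigr => c _; apply: eq_bigr => d _.
by rewrite tnth_mktuple mxvecE.
Qed.

Lemma comm_mpolyC (N : nat) (R : nzRingType) (c : R) (p : {mpoly R[N]}) :
  (forall e : R, GRing.comm e c) -> GRing.comm p c%:MP.
Proof.
move=> cc; elim/mpolyind: p => [|e m p _ _ IH]; first exact: commr_sym (commr0 _).
apply: commr_sym; apply: commrD; last exact: commr_sym.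
rewrite -mul_mpolyC; apply: commrM; last exact: commr_mpolyX.
by rewrite /GRing.comm -!mpolyCM (cc e).
Qed.

Lemma princ_minors_map (S S' : pzRingType) (f : {rmorphism S -> S'}) n k (Z : 'M[S]_n) :
  princ_minors k (map_mx f Z) = f (princ_minors k Z).
Proof.
rewrite raddf_sum; apply: eq_bigr => I _ /=.
rewrite /determinant raddf_sum; apply: eq_bigr => s _ /=.
rewrite rmorphM rmorph_sign rmorph_prod /=; congr (_ * _).
by apply: eq_bigr => a _; rewrite !mxE.
Qed.

Section Equivariance.
Context {K : numFieldType} {n r : nat}.
Notation P := {mpoly K[n * r]}.
Notation EndP := (endo K (n * r)).
Notation polymap := (polymap K n r).
Notation varX := (varX K n r).
Notation varY := (varY K n r).
Notation opX := (opX K n r).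
Notation opD := (opD K n r).
Notation scalmx := (@scalmx K n r).
Notation actGL := (@actGL K n r).
Notation actL := (@actL K n r).
Implicit Types (g h : 'M[K]_n) (F : polymap) (T : EndP).

Let glX g : 'M[P]_(n, r) := map_mx (@mpolyC (n * r) K) g^T *m varX.
Let gltup g : (n * r).-tuple P := [tuple mxvec (glX g) 0 k | k < n * r].

Let actGLE g p : actGL g p = comp_mpoly (gltup g) p.
Proof. by []. Qed.

Let actGL_varX g i a : actGL g (varX i a) = glX g i a.
Proof. by rewrite actGLE [varX i a]mxE comp_mpolyXU -tnth_nth tnth_mktuple mxvecE. Qed.

Let actGL_map g : map_mx (comp_mpoly (gltup g)) varX = glX g.
Proof. by apply/matrixP => i a; rewrite mxE; apply: actGL_varX. Qed.

Lemma actGLM g h : actGL g * actGL h = actGL (g *m h).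
Proof.
have Q i a : comp_mpoly (gltup g) (glX h i a) = glX (g *m h) i a.
  have := map_mxM (comp_mpoly (gltup g)) (map_mx (@mpolyC (n * r) K) h^T) varX.
  have -> : map_mx (comp_mpoly (gltup g)) (map_mx (@mpolyC (n * r) K) h^T)
            = map_mx (@mpolyC (n * r) K) h^T.
    by apply/matrixP => k l; rewrite !mxE comp_mpolyC.
  rewrite actGL_map /glX.
  by rewrite mulmxA -map_mxM -trmx_mul => /matrixP /(_ i a); rewrite mxE.
apply: endoP => p.
change (comp_mpoly (gltup g) (comp_mpoly (gltup h) p) = comp_mpoly (gltup (g *m h)) p).
rewrite [LHS]comp_mpoly_comp.
congr (comp_mpoly _ p).
apply: eq_from_tnth => k.
rewrite [LHS]tnth_mktuple.
rewrite [RHS]tnth_mktuple.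
rewrite [X in comp_mpoly _ X]tnth_mktuple.
case/mxvec_indexP: k => i a.
rewrite !mxvecE.
exact: Q.
Qed.

Lemma actGL1 : actGL 1%:M = 1.
Proof.
apply: endoP => p; change (comp_mpoly (gltup 1%:M) p = p).
rewrite -[RHS](comp_mpoly_id p); congr comp_mpoly.
apply: eq_from_tnth => k; rewrite !tnth_mktuple.
case/mxvec_indexP: k => i a; rewrite mxvecE /glX trmx1 map_mx1 mul1mx.
by rewrite mxE.
Qed.

Lemma mxvec_index_eq (i j : 'I_n) m (a b : 'I_m) :
  (mxvec_index i a == mxvec_index j b) = (i == j) && (a == b).
Proof.
have [h hK _] := curry_mxvec_bij n m.
apply/eqP/andP => [e|[/eqP-> /eqP->]] //.
have := congr1 h e.
by rewrite -[mxvec_index i a]/(uncurry (@mxvec_index n m) (i, a))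
  -[mxvec_index j b]/(uncurry (@mxvec_index n m) (j, b)) !hK // => -[-> ->].
Qed.

Let mderivXU N (R : nzRingType) (k l : 'I_N) :
  mderiv k ('X_l : {mpoly R[N]}) = (k == l)%:R.
Proof.
rewrite mderivX mnm1E eq_sym; case: eqP => [->|_]; last by rewrite scale0r.
rewrite scale1r (_ : (_ - _)%MM = 0%MM) ?mpolyX0 //.
by apply/mnmP => i; rewrite mnmBE subnn mnm0E.
Qed.

Let actGL_opX g i a :
  actGL g * opX i a = (\sum_k g k i *: opX k a) * actGL g.
Proof.
apply: endoP => p; rewrite [LHS]endoME [RHS]endoME endo_sumE [opX i a]mxE.
change (comp_mpoly (gltup g) (varX i a * p) = \sum_k (g k i *: opX k a) (actGL g p)).
rewrite rmorphM /= [X in X * _]actGL_varX mxE mulr_suml; apply: eq_bigr => k _.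
rewrite [RHS]endoZE [opX k a]mxE [X in X * varX k a]mxE [X in X%:MP]mxE.
by rewrite mul_mpolyC -scalerAl.
Qed.

Let mderiv_glX g j a c b :
  mderiv (mxvec_index j a) (glX g c b) = ((a == b)%:R * g j c)%:MP.
Proof.
rewrite [glX g c b]mxE raddf_sum (bigD1 j) //= [X in _ + X]big1 ?addr0 => [|k kj].
  rewrite [X in X * _]mxE [X in X%:MP]mxE mderiv_mulC [varX _ _]mxE mderivXU.
  by rewrite mxvec_index_eq eqxx /= -mpolyC_nat -mpolyCM mulrC.
rewrite [X in X * _]mxE mderiv_mulC [varX _ _]mxE mderivXU.
by rewrite mxvec_index_eq eq_sym (negPf kj) mulr0.
Qed.

Let opD_actGL g j a :
  opD j a * actGL g = actGL g * (\sum_c g j c *: opD c a).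
Proof.
apply: endoP => p; rewrite [LHS]endoME [RHS]endoME endo_sumE [opD j a]mxE.
change (mderiv (mxvec_index j a) (comp_mpoly (gltup g) p)
  = comp_mpoly (gltup g) (\sum_c (g j c *: opD c a) p)).
rewrite [LHS]mderiv_comp_mx [RHS]raddf_sum; apply: eq_bigr => c _.
rewrite (bigD1 a) //= big1 ?addr0 => [|b ba]; rewrite [X in _ * X]mderiv_glX.
  rewrite eqxx mul1r mulrC mul_mpolyC.
  by rewrite -[LHS]comp_mpolyZ [opD c a]mxE.
by rewrite eq_sym (negPf ba) mul0r mpolyC0 mulr0.
Qed.

Let actL_conj g a b : g \in unitmx ->
  \sum_i \sum_j (g a j * invmx g i b) *: (actGL g * actL i j * actGL (invmx g))
  = actL b a.
Proof.
move=> ug.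
have E i j : actGL g * actL i j * actGL (invmx g)
    = \sum_al (\sum_k g k i *: opX k al) * (\sum_c invmx g j c *: opD c al).
  rewrite /actL mulr_sumr mulr_suml; apply: eq_bigr => al _.
  rewrite mulrA [X in X * _ * _]actGL_opX -!mulrA; congr (_ * _).
  by rewrite opD_actGL mulrA actGLM mulmxV // actGL1 mul1r.
under eq_bigr do under eq_bigr do rewrite E.
under eq_bigr do under eq_bigr do rewrite scaler_sumr.
under eq_bigr do rewrite exchange_big /=.
rewrite exchange_big; apply: eq_bigr => al _ /=.
have sumX : \sum_i invmx g i b *: (\sum_k g k i *: opX k al) = opX b al.
  under eq_bigr do rewrite scaler_sumr.
  rewrite exchange_big (bigD1 b) //= [X in _ + X]big1 ?addr0 => [|k kb].
    under eq_bigr do rewrite scalerA mulrC.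
    rewrite -scaler_suml; have /matrixP/(_ b b) := mulmxV ug.
    by rewrite !mxE eqxx => ->; rewrite scale1r.
  under eq_bigr do rewrite scalerA mulrC.
  rewrite -scaler_suml; have /matrixP/(_ k b) := mulmxV ug.
  by rewrite !mxE (negPf kb) => ->; rewrite scale0r.
have sumD : \sum_j g a j *: (\sum_c invmx g j c *: opD c al) = opD a al.
  under eq_bigr do rewrite scaler_sumr.
  rewrite exchange_big (bigD1 a) //= [X in _ + X]big1 ?addr0 => [|c ca].
    under eq_bigr do rewrite scalerA.
    rewrite -scaler_suml; have /matrixP/(_ a a) := mulmxV ug.
    by rewrite !mxE eqxx => ->; rewrite scale1r.
  under eq_bigr do rewrite scalerA.
  rewrite -scaler_suml; have /matrixP/(_ a c) := mulmxV ug.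
  by rewrite !mxE eq_sym (negPf ca) => ->; rewrite scale0r.
rewrite -[in RHS]sumX -[in RHS]sumD mulr_suml; apply: eq_bigr => i _.
rewrite mulr_sumr; apply: eq_bigr => j _.
by rewrite -scalerAl -scalerAr scalerA mulrC.
Qed.

Let central (F : polymap) := forall G : polymap, GRing.comm G F.

Fact central_scal (c : K) : central (cst c%:A).
Proof.
move=> G; apply: comm_mpolyC => e.
by rewrite /GRing.comm -scalerAl -scalerAr mul1r mulr1.
Qed.

Let conjY g := scalmx g *m varY *m scalmx (invmx g).

Let central_conjY g k : central (mxvec (conjY g) 0 k).
Proof.
case/mxvec_indexP: k => a b; rewrite mxvecE mxE => G.
apply: commr_sum => i _; apply: commrM; last by rewrite mxE; apply: central_scal.
rewrite mxE; apply: commr_sum => j _.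
apply: commrM; first by rewrite mxE; apply: central_scal.
by rewrite mxE; apply: commr_mpolyX.
Qed.

Let mderiv_conjY g i j a b :
  mderiv (mxvec_index j i) (conjY g a b) = cst (g a j * invmx g i b)%:A.
Proof.
have E l : mderiv (mxvec_index j i) ((scalmx g *m varY) a l * scalmx (invmx g) l b)
    = (i == l)%:R * cst (g a j * invmx g l b)%:A.
  rewrite mderivM [scalmx _ l b]mxE mderivC mulr0 addr0.
  rewrite [X in mderiv _ X * _]mxE raddf_sum (bigD1 j) //=.
  rewrite [X in _ + X]big1 ?addr0 => [|k kj].
    rewrite [scalmx _ a j]mxE mderiv_mulC [varY _ _]mxE mderivXU mxvec_index_eq eqxx /=.
    case: (i == l); last by rewrite mulr0 !mul0r.
    by rewrite mulr1 mul1r /cst -mpolyCM -scalerAl mul1r scalerA.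
  rewrite [scalmx _ a k]mxE mderiv_mulC [varY _ _]mxE mderivXU mxvec_index_eq.
  by rewrite eq_sym (negPf kj) mulr0.
rewrite [conjY g a b]mxE raddf_sum (bigD1 i) //= E eqxx mul1r.
by rewrite big1 ?addr0 // => l li; rewrite E eq_sym (negPf li) mul0r.
Qed.

Fact subY_conjYM g F G : subY (conjY g) (F * G) = subY (conjY g) F * subY (conjY g) G.
Proof. by apply: mmap_centralM => k G'; apply: central_conjY. Qed.

Let cstM T U : cst (T * U) = cst T * cst U :> polymap.
Proof. by rewrite /cst mpolyCM. Qed.

Lemma KWop_equivariant F : equivariant F -> equivariant (KWop F).
Proof.
move=> eqF g ug; rewrite -/(conjY g).
have dconj i j : cst (actGL g) * mderiv (mxvec_index j i) F * cst (actGL (invmx g))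
    = \sum_a \sum_b subY (conjY g) (mderiv (mxvec_index a b) F)
        * cst (g a j * invmx g i b)%:A.
  have := congr1 (mderiv (mxvec_index j i)) (eqF g ug).
  rewrite -/(conjY g) [LHS]mderiv_mmap => [||l G]; last first.
  - case/mxvec_indexP: l => a b; rewrite mxvecE mderiv_conjY; exact: central_scal.
  - exact: central_conjY.
  rewrite mxvecsum [X in _ = X]mderivM mderivC mulr0 addr0 mderiv_mulC => <-.
  by apply: eq_bigr => a _; apply: eq_bigr => b _; rewrite mxvecE mderiv_conjY.
have dconjL i j : cst (actGL g) * (mderiv (mxvec_index j i) F * cst (actL i j))
      * cst (actGL (invmx g))
    = \sum_a \sum_b subY (conjY g) (mderiv (mxvec_index a b) F)
        * cst ((g a j * invmx g i b) *: (actGL g * actL i j * actGL (invmx g))).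
  have r1 : cst (actGL (invmx g)) * cst (actGL g) = 1 :> polymap.
    by rewrite -cstM actGLM mulVmx // actGL1 /cst mpolyC1.
  rewrite -[cst (actL i j)]mul1r -r1 !mulrA dconj -!mulrA -!cstM !mulrA.
  rewrite mulr_suml; apply: eq_bigr => a _; rewrite mulr_suml; apply: eq_bigr => b _.
  by rewrite -mulrA -cstM -scalerAl mul1r.
rewrite /KWop mulr_sumr mulr_suml.
under [RHS]eq_bigr do rewrite mulr_sumr mulr_suml.
under [RHS]eq_bigr do under eq_bigr do rewrite dconjL.
rewrite /subY raddf_sum /= -/(subY (conjY g)).
under [LHS]eq_bigr do rewrite raddf_sum /=.
rewrite [LHS]exchange_big /=.
under [RHS]eq_bigr do rewrite exchange_big /=.
rewrite [RHS]exchange_big /=; apply: eq_bigr => a _.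
under [RHS]eq_bigr do rewrite exchange_big /=.
rewrite [RHS]exchange_big /=; apply: eq_bigr => b _.
rewrite -/(subY (conjY g) _) subY_conjYM [X in _ * X]mmapC -(actL_conj a b ug).
rewrite /cst raddf_sum mulr_sumr; apply: eq_bigr => i _ /=.
by rewrite raddf_sum mulr_sumr.
Qed.

Let iota : {mpoly K[n * n]} -> polymap := map_mpoly (in_alg EndP).

Let central_iota p : central (iota p).
Proof.
rewrite /iota; elim/mpolyind: p => [|c m p _ _ IH] G.
  by rewrite raddf0; apply: commr0.
rewrite raddfD /=; apply: commrD; last exact: IH.
rewrite map_mpolyZ map_mpolyX -mul_mpolyC.
by apply: commrM; [apply: central_scal | apply: commr_mpolyX].
Qed.

Let YK : 'M[{mpoly K[n * n]}]_n := \matrix_(i, j) 'X_(mxvec_index i j).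
Let gK g : 'M[{mpoly K[n * n]}]_n := map_mx (@mpolyC (n * n) K) g.

Let iota_YK : map_mx iota YK = varY.
Proof. by apply/matrixP => i j; rewrite !mxE /iota map_mpolyX. Qed.

Let iota_gK g : map_mx iota (gK g) = scalmx g.
Proof. by apply/matrixP => i j; rewrite !mxE /iota map_mpolyC. Qed.

Lemma ck_equivariant k : equivariant (ck K n r k).
Proof.
move=> g ug; rewrite -/(conjY g).
pose S : {rmorphism polymap -> polymap} := HB.pack
  (mmap (@mpolyC (n * n) EndP) (mxvec (conjY g) 0))
  (GRing.isMultiplicative.Build _ _ _ (mmap_central_mult (central_conjY g))).
have eqc : ck K n r k = iota (princ_minors k YK).
  by rewrite /ck -iota_YK; apply: princ_minors_map.
have SY : map_mx S varY = conjY g.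
  apply/matrixP => a b; rewrite [LHS]mxE [varY a b]mxE.
  by rewrite [LHS]mmapX mmap1U mxvecE.
have -> : cst (actGL g) * ck K n r k * cst (actGL (invmx g)) = ck K n r k.
  rewrite eqc central_iota -mulrA -cstM actGLM mulmxV // actGL1 /cst.
  by rewrite mpolyC1 mulr1.
rewrite -[LHS]/(S (ck K n r k)) /ck -princ_minors_map SY /conjY.
rewrite -/(ck K n r k) eqc -iota_YK -!iota_gK -!map_mxM [LHS]princ_minors_map.
congr iota; rewrite -mulmxA princ_minorsC.
  by rewrite -mulmxA /gK -map_mxM (mulVmx ug) map_mx1 mulmx1.
apply: mulIf; rewrite -mpolyC_nat mpolyC_eq0 pnatr_eq0 -lt0n; exact: fact_gt0.
Qed.

End Equivariance.

Section KirillovWei.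
Context (K : numFieldType) (n r : nat).

Record equivmap := EquivMap {
  emap :> polymap K n r;
  emapP : equivariant emap }.

Definition KW (F : equivmap) : equivmap := EquivMap (KWop_equivariant (emapP F)).

Definition Mpq (p q : nat) : equivmap :=
  iter q KW (EquivMap (@ck_equivariant K n r (p + q))).

(* All the generators are equivariant, hence so is every element: see
   big_algebra_equivariant. *)
Definition big_algebra : polymap K n r -> Prop :=
  subalg_gen (fun F => exists p q : nat, (p + q <= n)%N /\ F = Mpq p q).

Lemma big_algebra_equivariant F : big_algebra F -> equivariant F.
Proof.
have conjM (A : nzRingType) (a b x y : A) : b * a = 1 ->
    a * x * b * (a * y * b) = a * (x * y) * b.
  by move=> ba; rewrite -[a * y * b]mulrA [_ * (a * _)]mulrA -[_ * b * a]mulrA ba mulr1 !mulrA.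
elim=> {F} [F [p [q [_ ->]]]|c|F1 F2 _ e1 _ e2|F1 F2 _ e1 _ e2] g ug.
- exact: emapP.
- rewrite [LHS]mmapC.
  have -> : cst (actGL r g) * cst c%:A = cst c%:A * cst (actGL r g) :> polymap K n r.
    exact: central_scal.
  rewrite -mulrA.
  by rewrite -[X in _ * X]mpolyCM actGLM mulmxV // actGL1 mpolyC1 mulr1.
- by rewrite [LHS]mmapD mulrDr mulrDl -(e1 g ug) -(e2 g ug).
- rewrite [LHS]subY_conjYM e1 // e2 //; apply: conjM.
  by rewrite /cst -mpolyCM actGLM mulVmx // actGL1 mpolyC1.
Qed.

End KirillovWei.

(* Main.v *)
Require Import Defs.
From HB Require Import structures.
From mathcomp Require Import all_boot all_order all_fingroup all_algebra.
From mathcomp Require Import zify ring.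
From mathcomp Require Import reals complex mpoly.

Import Order.TTheory GRing.Theory Num.Theory.
Local Open Scope ring_scope.

Set Implicit Arguments.
Unset Strict Implicit.
Unset Printing Implicit Defensive.

(** Write kron f g = det [f a == g b] for the generalized Kronecker delta of
    f, g : [m] -> [n], and :w: for the differential operator with symbol w, all
    derivations to the right. With Z_ij the symbol of L(E_ji), antisymmetry and
    the Cauchy-Binet formula give, for m = p + q,
      p! q! F_{p,q} = \sum_(f, g) kron f g \prod_(a < p) y_{f a, g a}
                                           :\prod_(p <= a) Z_{f a, g a}: .
    Applying D to the right-hand side replaces a factor y_{f a, g a} by
    L(E_{g a, f a}) on the right. Its normally ordered part turns the slot a from
    a y-slot into a Z-slot; the commutator with a Z-slot c forces f c = g a, and
    swapping f a with f c contracts kron over one index, which yields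
    -(n - (m - 1)) times the sum for m - 1. Hence
      D F_{p+1,q} = (q + 1) F_{p,q+1} - q (n - p - q) F_{p,q},
    and the formula for M_{p,q} follows by induction on q from the recurrence of
    the Stirling numbers. It is triangular with invertible diagonal entries q!,
    so the two families generate the same algebra. *)

(** * Stirling numbers *)

Section Stirling.
Local Open Scope nat_scope.

Fixpoint stirling_rec (q l : nat) : nat :=
  match q, l with
  | 0, 0 => 1
  | 0, _.+1 => 0
  | _.+1, 0 => 0
  | q'.+1, l'.+1 => l'.+1 * stirling_rec q' l'.+1 + stirling_rec q' l'
  end.

Lemma stirling_rec_gt q l : q < l -> stirling_rec q l = 0.
Proof.
elim: q l => [|q IH] [|l] //= lt; rewrite !IH ?muln0 //.
exact: ltn_trans lt.
Qed.

Lemma stirling_recnn q : stirling_rec q q = 1.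
Proof. by elim: q => //= q ->; rewrite stirling_rec_gt // muln0. Qed.

Section Partitions.
Context (T : finType).
Implicit Types (D B C : {set T}) (P Q : {set {set T}}).

Let parts D l := [set P | partition P D & #|P| == l].

(* The partitions of x |: D are obtained from those of D by inserting x in a
   block B, where B = set0 stands for a new block. *)
Let insert x (u : {set {set T}} * {set T}) := (x |: u.2) |: (u.1 :\ u.2).

(** Inverse of [insert x]: an emptied block is dropped, and the shrunken block is returned to
    remember where [x] was. *)
Let remove x Q : {set {set T}} * {set T} :=
  let B := pblock Q x :\ x in
  ((if B == set0 then set0 else [set B]) :|: (Q :\ pblock Q x), B).

Lemma card_parts0 l : #|parts set0 l| = (l == 0).
Proof.
case: l => [|l]; last first.
  apply/eqP; rewrite cards_eq0; apply/eqP/setP=> P.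
  by rewrite !inE partition_set0; case: eqP => // ->; rewrite cards0.
apply/eqP/cards1P; exists set0; apply/setP=> P.
by rewrite !inE partition_set0; case: eqP => // ->; rewrite cards0.
Qed.

Lemma card_partsU1_0 x D : #|parts (x |: D) 0| = 0.
Proof.
apply/eqP; rewrite cards_eq0; apply/eqP/setP=> P; rewrite !inE cards_eq0.
apply/andP => -[/cover_partition + /eqP P0]; rewrite P0 /cover big_set0 => /setP/(_ x).
by rewrite !inE eqxx.
Qed.

(** [insert x] maps the admissible pairs (P, B) bijectively onto the partitions counted on the left:
    a partition into l+1 blocks offers each of its blocks as B, one into l blocks only [set0]. *)
Lemma card_partsU1 x D l : x \notin D ->
  #|parts (x |: D) l.+1| = l.+1 * #|parts D l.+1| + #|parts D l|.
Proof.
move=> xD.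
pose S := [set u : {set {set T}} * {set T} | partition u.1 D &
   (u.2 == set0) && (#|u.1| == l) || (u.2 \in u.1) && (#|u.1| == l.+1)].
have cardS : #|S| = l.+1 * #|parts D l.+1| + #|parts D l|.
  have -> : #|S| = \sum_P \sum_(B | (P, B) \in S) 1.
    by rewrite pair_big_dep -sum1_card; apply: eq_bigl => -[].
  rewrite (eq_bigr (fun P => l.+1 * (P \in parts D l.+1) + (P \in parts D l))).
    by rewrite big_split /= -big_distrr -!sum1_card ![\sum_(_ in parts _ _) _]big_mkcond.
  move=> P _; rewrite sum1_card.
  rewrite (@eq_card _ _ (mem [set B | (P, B) \in S])) => [|B]; last by rewrite inE.
  rewrite !inE; case pP: (partition P D); last first.
    by rewrite muln0; apply/eqP; rewrite cards_eq0; apply/eqP/setP=> B; rewrite !inE /= pP.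
  have [cl|nl] := eqVneq #|P| l.
    rewrite cl eqn_leq ltnn andbF muln0; apply/eqP/cards1P; exists set0.
    by apply/setP=> B; rewrite !inE /= pP cl eqxx eqn_leq ltnn andbF andbF orbF andbT.
  have [cl|nl'] := eqVneq #|P| l.+1; rewrite /= ?muln1 ?muln0 addn0.
    rewrite -cl; apply: eq_card => B.
    by rewrite !inE /= pP cl (gtn_eqF (ltnSn l)) andbF eqxx andbT.
  apply/eqP; rewrite cards_eq0; apply/eqP/setP=> B.
  by rewrite !inE /= pP (negPf nl) (negPf nl') !andbF.
have insK : {in S, cancel (insert x) (remove x)}.
  move=> [P B]; rewrite inE /= => /andP[pP BP].
  have PxB : x |: B \notin P.
    apply/negP => /(partitionS pP)/subsetP/(_ x); rewrite setU11 => /(_ isT).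
    by rewrite (negPf xD).
  have xB : x \notin B.
    case/orP: BP => /andP[BP _]; first by rewrite (eqP BP) inE.
    by apply: contra xD; apply/subsetP; apply: partitionS BP.
  have pb : pblock (insert x (P, B)) x = x |: B.
    apply: def_pblock; rewrite ?setU11 //.
    apply: (proj1 (trivIsetU1 _ _ _)) => /= [C||].
    - rewrite !inE => /andP[CB CP]; rewrite disjoints_subset subUset sub1set inE.
      apply/andP; split; last rewrite -disjoints_subset.
        by apply: contra xD; apply/subsetP; apply: partitionS CP.
      case/orP: BP => /andP[BP _]; first by rewrite (eqP BP) disjoints_subset sub0set.
      by move/partition_trivIset/trivIsetP: pP; apply=> //; rewrite eq_sym.
    - exact/trivIsetD/(partition_trivIset pP).
    - by rewrite inE (partition0 pP) andbF.
  rewrite /remove pb setU1K // /insert /=; congr pair.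
  rewrite setU1K ?inE ?(negPf PxB) ?andbF //.
  case/orP: BP => /andP[BP _]; last first.
    by rewrite (negPf (partition_neq0 pP BP)) setD1K.
  by rewrite BP set0U (eqP BP); apply/setDidPl; rewrite disjoint_sym disjoints1 (partition0 pP).
have insS : insert x @: S = parts (x |: D) l.+1.
  apply/setP=> Q; apply/imsetP/idP => [[[P B]]|].
    rewrite !inE /= => /andP[pP BP] ->; rewrite /insert /=.
    have sBD : B \subset D.
      by case/orP: BP => /andP[BP _]; rewrite ?(eqP BP) ?sub0set // (partitionS pP).
    have PxB : x |: B \notin P.
      apply/negP => /(partitionS pP)/subsetP/(_ x); rewrite setU11 => /(_ isT).
      by rewrite (negPf xD).
    have pPB : partition (P :\ B) (D :\: B).
      case/orP: BP => /andP[BP _]; last exact: partitionD1.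
      rewrite (eqP BP) setD0 (_ : P :\ set0 = P) //.
      by apply/setDidPl; rewrite disjoint_sym disjoints1 (partition0 pP).
    apply/andP; split.
      have -> : x |: D = (x |: B) :|: (D :\: B).
        apply/setP=> y; rewrite !inE -orbA; case: (y == x) => //=.
        by case: (boolP (y \in B)) => //= /(subsetP sBD) ->.
      apply: partitionU1 => //; first by apply/set0Pn; exists x; rewrite setU11.
      rewrite disjoints_subset subUset sub1set !inE (negPf xD) andbF /=.
      by apply/subsetP=> y yB; rewrite !inE yB.
    rewrite cardsU1 inE (negPf PxB) andbF /= add1n eqSS.
    case/orP: BP => /andP[BP /eqP cP].
      rewrite (eqP BP) (_ : P :\ set0 = P) ?cP //.
      by apply/setDidPl; rewrite disjoint_sym disjoints1 (partition0 pP).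
    by rewrite -eqSS -cP [in X in _ == X](cardsD1 B) BP.
  rewrite inE => /andP[pQ cQ].
  set C := pblock Q x; pose B := C :\ x.
  have xcQ : x \in cover Q by rewrite (cover_partition pQ) setU11.
  have CQ : C \in Q by apply: pblock_mem.
  have xC : x \in C by rewrite mem_pblock.
  have BQ : B \notin Q.
    apply/negP => BQ; have /set0Pn[y yB] := partition_neq0 pQ BQ.
    have yC : y \in C by move: yB; rewrite !inE => /andP[].
    have := def_pblock (partition_trivIset pQ) BQ yB.
    rewrite (def_pblock (partition_trivIset pQ) CQ yC) => eCB.
    by move: xC; rewrite eCB !inE eqxx.
  exists (remove x Q).
    have pQC := partitionD1 pQ CQ; have := cQ; rewrite (cardsD1 C) CQ eqSS => cQC.
    rewrite inE /remove -/C -/B /=; have [B0|B0] := eqVneq B set0.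
      rewrite set0U cQC orTb andbT.
      suff <- : (x |: D) :\: C = D by [].
      by rewrite -(setD1K xC) -/B B0 setU0 setU1K.
    rewrite !inE eqxx /= cardsU1 !inE (negPf BQ) andbF add1n eqSS cQC andbT.
    suff <- : B :|: (x |: D) :\: C = D.
      apply: partitionU1 => //; rewrite disjoints_subset.
      by apply/subsetP=> y; rewrite !inE => /andP[_ ->].
    apply/setP=> y; rewrite !inE; have [->|yx] /= := eqVneq y x.
      by rewrite xC (negPf xD).
    case yC: (y \in C) => //=; apply/esym.
    by move/subsetP/(_ y yC): (partitionS pQ CQ); rewrite !inE (negPf yx).
  rewrite /insert /remove -/C -/B /= setD1K // setDUl.
  have -> : (if B == set0 then set0 else [set B]) :\ B = set0.
    by case: eqP => _; rewrite ?set0D ?setDv.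
  rewrite set0U (_ : Q :\ C :\ B = Q :\ C) ?setD1K //.
  by apply/setDidPl; rewrite disjoint_sym disjoints1 inE (negPf BQ) andbF.
rewrite -insS card_in_imset //.
exact: can_in_inj insK.
Qed.

Lemma card_parts D l : #|parts D l| = stirling_rec #|D| l.
Proof.
elim: {D}_.+1 {-2}D (ltnSn #|D|) l => // k IH D.
have [->|[x xD]] := set_0Vmem D; first by rewrite cards0 => _ l; rewrite card_parts0; case: l.
rewrite -(setD1K xD) cardsU1 !inE eqxx add1n => lt [|l].
  by rewrite card_partsU1_0.
by rewrite card_partsU1 ?inE ?eqxx //= !IH.
Qed.

End Partitions.

End Stirling.

(** * The generalized Kronecker delta *)

Section Kronecker.
Context (n : nat).

Definition kron m (f g : 'I_m -> 'I_n) : int :=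
  \det (\matrix_(a, b) (f a == g b)%:R).

Lemma eq_kron m (f f' g g' : 'I_m -> 'I_n) :
  f =1 f' -> g =1 g' -> kron f g = kron f' g'.
Proof. by move=> ef eg; congr determinant; apply/matrixP => a b; rewrite !mxE ef eg. Qed.

Lemma kronC m (f g : 'I_m -> 'I_n) : kron f g = kron g f.
Proof.
by rewrite /kron -det_tr; congr determinant; apply/matrixP => a b; rewrite !mxE eq_sym.
Qed.

Lemma kron_noninj m (f g : 'I_m -> 'I_n) : ~~ injectiveb f -> kron f g = 0.
Proof.
case/injectivePn => a [b ab fab].
by apply: (determinant_alternate ab) => c; rewrite !mxE fab.
Qed.

Lemma kron_perm m (f g : 'I_m -> 'I_n) (s : 'S_m) :
  kron (f \o s) g = (-1) ^+ s * kron f g.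
Proof.
rewrite /kron -det_perm -det_mulmx -row_permE; congr determinant.
by apply/matrixP => a b; rewrite !mxE.
Qed.

Definition insert_at m (h : 'I_m.+1) (i : 'I_n) (f : 'I_m -> 'I_n) (a : 'I_m.+1) :=
  if unlift h a is Some b then f b else i.

Lemma insert_atE m (h : 'I_m.+1) i (f : 'I_m -> 'I_n) : insert_at h i f h = i.
Proof. by rewrite /insert_at unlift_none. Qed.

Lemma insert_at_lift m (h : 'I_m.+1) i (f : 'I_m -> 'I_n) b :
  insert_at h i f (lift h b) = f b.
Proof. by rewrite /insert_at liftK. Qed.

(* If i = g b, two columns of the left-hand determinant agree; otherwise its row h
   is a unit vector. *)
Lemma kron_insert m (h : 'I_m.+1) i (f g : 'I_m -> 'I_n) :
  kron (insert_at h i f) (insert_at h i g) =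
  if i \in codom g then 0 else kron f g.
Proof.
case: ifP => [/codomP [b ib]|ng].
  rewrite kronC; apply: kron_noninj; apply/injectivePn; exists h, (lift h b).
    by rewrite neq_lift.
  by rewrite insert_atE insert_at_lift.
rewrite /kron (expand_det_row _ h) (bigD1 h) //= [X in _ + X]big1 ?addr0 => [|b bh].
  rewrite mxE !insert_atE eqxx mul1r /cofactor -signr_odd oddD addbb mul1r.
  by congr determinant; apply/matrixP => a b; rewrite !mxE !insert_at_lift.
case: (unliftP h b) bh => [c ->|->]; last by rewrite eqxx.
rewrite mxE insert_atE insert_at_lift => _; case: eqP => [e|_]; last by rewrite mul0r.
by rewrite e codom_f in ng.
Qed.

(** For injective [g] exactly n - m values [i] avoid its image, and each contributes [kron f g].
    Otherwise both sides are zero, so the truncated subtraction is harmless. *)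
Lemma kron_contract m (h : 'I_m.+1) (f g : 'I_m -> 'I_n) :
  \sum_i kron (insert_at h i f) (insert_at h i g) = kron f g *+ (n - m).
Proof.
under eq_bigr do rewrite kron_insert -if_neg.
rewrite -big_mkcond sumr_const.
have [/injectiveP inj_g|ninj] := boolP (injectiveb g); last first.
  by rewrite kronC kron_noninj // !mul0rn.
congr (_ *+ _); rewrite -[in RHS](card_ord n) -(cardC (mem (codom g))).
by rewrite card_codom // card_ord addKn.
Qed.

(** The analogue of [catidx] for arbitrary maps: [catidx I J] unfolds to
    [fcat (kidx I) (kidx J)]. *)
Definition fcat p q (f1 : 'I_p -> 'I_n) (f2 : 'I_q -> 'I_n) (a : 'I_(p + q)) :=
  match split a with inl b => f1 b | inr c => f2 c end.

Lemma fcat_lshift p q (f1 : 'I_p -> 'I_n) (f2 : 'I_q -> 'I_n) b :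
  fcat f1 f2 (lshift q b) = f1 b.
Proof. by rewrite /fcat (unsplitK (inl b)). Qed.

Lemma fcat_rshift p q (f1 : 'I_p -> 'I_n) (f2 : 'I_q -> 'I_n) b :
  fcat f1 f2 (rshift p b) = f2 b.
Proof. by rewrite /fcat (unsplitK (inr b)). Qed.

Lemma fcat_noninj p q (f1 : 'I_p -> 'I_n) (f2 : 'I_q -> 'I_n) :
  ~~ (injectiveb f1 && injectiveb f2) -> ~~ injectiveb (fcat f1 f2).
Proof.
rewrite negb_and => /orP[] /injectivePn [a [b ab eab]]; apply/injectivePn.
  by exists (lshift q a), (lshift q b); rewrite ?eq_lshift // !fcat_lshift.
by exists (rshift p a), (rshift p b); rewrite ?eq_rshift // !fcat_rshift.
Qed.

(** Left multiplication by the block-diagonal matrix of the two permutation matrices permutes the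
    rows of the delta matrix, and the determinant of that factor is the product of the signs. *)
Lemma kron_fcat_perm p q (f1 : 'I_p -> 'I_n) (f2 : 'I_q -> 'I_n) g (s1 : 'S_p) (s2 : 'S_q) :
  kron (fcat (f1 \o s1) (f2 \o s2)) g = (-1) ^+ s1 * (-1) ^+ s2 * kron (fcat f1 f2) g.
Proof.
rewrite /kron -2!det_perm -(det_ublock _ 0) -det_mulmx; congr determinant.
set M := \matrix_(a, b) (fcat f1 f2 a == _)%:R.
rewrite -[M]vsubmxK mul_block_col !mul0mx addr0 add0r -!row_permE.
rewrite -[LHS]vsubmxK; congr col_mx; apply/matrixP => a b.
  by rewrite !mxE !fcat_lshift.
by rewrite !mxE !fcat_rshift.
Qed.

End Kronecker.

(** * Sums over index functions, regrouped by images or by slots *)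

Section SumSubsets.
Context (n k : nat) (V : nmodType).

(** An injective map is, in a unique way, the increasing listing of its image precomposed with a
    permutation. *)
Lemma sum_ffun_ksub (F : {ffun 'I_k -> 'I_n} -> V) :
  (forall f : {ffun 'I_k -> 'I_n}, ~~ injectiveb f -> F f = 0) ->
  \sum_f F f = \sum_(I : ksub n k) \sum_(s : 'S_k) F [ffun a => kidx I (s a)].
Proof.
move=> F0; pose h (x : ksub n k * 'S_k) := [ffun a => kidx x.1 (x.2 a)].
have h_inj : injective h.
  move=> [I s] [J t] /ffunP eqh.
  have eIJ : I = J.
    apply: val_inj; rewrite -!kidx_imset; apply/setP => i; apply/imsetP/imsetP => -[a _ ->].
      by exists (t (s^-1 a)%g) => //; have := eqh (s^-1 a)%g; rewrite !ffunE /= permKV.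
    by exists (s (t^-1 a)%g) => //; have := eqh (t^-1 a)%g; rewrite !ffunE /= permKV.
  rewrite -eIJ in eqh *; congr (_, _); apply/permP => a.
  by have := eqh a; rewrite !ffunE => /kidx_inj.
(* Since [h] is injective, a count suffices: C(n, k) k! is the number of injective maps. *)
have hT : h @: setT = [set f : {ffun 'I_k -> 'I_n} | injectiveb f].
  apply/eqP; rewrite eqEcard; apply/andP; split.
    apply/subsetP => _ /imsetP[x _ ->]; rewrite inE; apply/injectiveP => a b.
    by rewrite !ffunE => /kidx_inj /perm_inj.
  rewrite card_imset // cardsT card_prod card_inj_ffuns !card_ord card_Sn.
  have := card_draws 'I_n k; rewrite card_ord => cks.
  rewrite card_sig -bin_ffact -cks; apply: eq_leq.
  by congr (_ * _)%N; apply: eq_card => I; rewrite !inE.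
rewrite (bigID (fun f : {ffun 'I_k -> 'I_n} => injectiveb f)) /=.
rewrite [X in _ + X]big1 ?addr0 => [|f]; last exact: F0.
rewrite (eq_bigl (fun f => f \in h @: setT)) => [|f]; last by rewrite hT inE.
rewrite big_imset /= => [|x y _ _]; last exact: h_inj.
rewrite (eq_bigl xpredT) => [|x]; last by rewrite inE.
by rewrite -(pair_bigA _ (fun I s => F (h (I, s)))).
Qed.

End SumSubsets.

Lemma sum_ffun_ksub2 (n k : nat) (V : nmodType)
    (F : {ffun 'I_k -> 'I_n} -> {ffun 'I_k -> 'I_n} -> V) :
  (forall f g : {ffun 'I_k -> 'I_n}, ~~ (injectiveb f && injectiveb g) -> F f g = 0) ->
  \sum_f \sum_g F f g = \sum_(I : ksub n k) \sum_(J : ksub n k)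
    \sum_(s : 'S_k) \sum_(t : 'S_k) F [ffun a => kidx I (s a)] [ffun a => kidx J (t a)].
Proof.
move=> F0; rewrite sum_ffun_ksub => [|f nf]; last first.
  by rewrite big1 // => g _; rewrite F0 // (negPf nf).
apply: eq_bigr => I _; rewrite [RHS]exchange_big /=; apply: eq_bigr => s _.
by rewrite sum_ffun_ksub // => g ng; rewrite F0 // (negPf ng) andbF.
Qed.

(** For fixed [s] the inner sum is the sign of [s] times the Leibniz expansion of the row-permuted
    matrix, that is [\det A]. *)
Lemma sum_det_perm2 (S : comNzRingType) k (A : 'M[S]_k) :
  \sum_(s : 'S_k) \sum_(t : 'S_k) (\prod_a A (s a) (t a)) *~ ((-1) ^+ s * (-1) ^+ t)
  = \det A *+ k`!.
Proof.
rewrite -card_Sn -sumr_const; apply: eq_bigr => s _.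
have -> : \det A = (-1) ^+ s * \det (row_perm s A).
  by rewrite row_permE det_mulmx det_perm mulrA -signr_addb addbb mul1r.
rewrite mulr_sumr; apply: eq_bigr => t _.
rewrite -mulrzl intrM !rmorph_sign mulrA; congr (_ * _).
by apply: eq_bigr => a _; rewrite mxE.
Qed.

Lemma sum_ffun_split (n p q : nat) (V : nmodType) (F : {ffun 'I_(p + q) -> 'I_n} -> V) :
  \sum_f F f = \sum_(f1 : {ffun 'I_p -> 'I_n}) \sum_(f2 : {ffun 'I_q -> 'I_n})
    F [ffun a => fcat f1 f2 a].
Proof.
rewrite pair_bigA /=.
rewrite (reindex (fun x : {ffun 'I_p -> 'I_n} * {ffun 'I_q -> 'I_n} =>
  [ffun a => fcat x.1 x.2 a])) //=.
exists (fun f : {ffun 'I_(p + q) -> 'I_n} =>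
   ([ffun a => f (lshift q a)], [ffun a => f (rshift p a)])) => [[f1 f2] _|f _].
  by congr pair; apply/ffunP => a; rewrite !ffunE ?fcat_lshift ?fcat_rshift.
apply/ffunP => a; rewrite ffunE /fcat -[in RHS](splitK a).
by case: (split a) => b; rewrite ffunE.
Qed.

Lemma sum_ffun_insert (n m : nat) (h : 'I_m.+1) (V : nmodType) (F : {ffun 'I_m.+1 -> 'I_n} -> V) :
  \sum_f F f = \sum_i \sum_(f : {ffun 'I_m -> 'I_n}) F [ffun a => insert_at h i f a].
Proof.
rewrite pair_bigA /=.
rewrite (reindex (fun x : 'I_n * {ffun 'I_m -> 'I_n} => [ffun a => insert_at h x.1 x.2 a])) //=.
exists (fun f : {ffun 'I_m.+1 -> 'I_n} => (f h, [ffun a => f (lift h a)])) => [[i f] _|f _].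
  rewrite ffunE insert_atE; congr pair.
  by apply/ffunP => a; rewrite !ffunE insert_at_lift.
apply/ffunP => a; rewrite ffunE /insert_at.
by case: unliftP => [b ->|->]; rewrite ?ffunE.
Qed.

Lemma big_lift (R : Type) (idx : R) (op : Monoid.com_law idx) n (j : 'I_n) (P : pred 'I_n) F :
  \big[op/idx]_(i | P i && (i != j)) F i = \big[op/idx]_(k < n.-1 | P (lift j k)) F (lift j k).
Proof.
rewrite (reindex_omap (lift j) (unlift j)) /=.
  by apply: eq_bigl => k; rewrite liftK eqxx andbT eq_sym neq_lift andbT.
by move=> i; case: unliftP => [k ->|->]; rewrite ?eqxx ?andbF.
Qed.

(** * Sums weighted by the Kronecker delta, over abstract coefficient rings *)

Section KronSums.
Context (n : nat) (U1 U2 : comNzRingType) (V : nzRingType).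
Context (phi1 : {additive U1 -> V}) (phi2 : {additive U2 -> V}).
Context (Y : 'M[U1]_n) (Z : 'M[U2]_n).

(** The double sum of the overview, with m slots of which the first p are y-slots. Products are
    formed in the commutative rings [U1] and [U2] before being carried to [V]; the maps are merely
    additive because normal ordering is not multiplicative. *)
Definition kron_sum m p : V :=
  \sum_(f : {ffun 'I_m -> 'I_n}) \sum_(g : {ffun 'I_m -> 'I_n})
    (phi1 (\prod_(a : 'I_m | (a < p)%N) Y (f a) (g a))
     * phi2 (\prod_(a : 'I_m | (p <= a)%N) Z (f a) (g a))) *~ kron f g.

(** Each half of [f] and of [g] is a subset with an ordering. The signs of the orderings come out of
    [kron] and build the two minors; by [sum_det_perm2] these are counted p! and q! times. *)
Lemma kron_sum_ksub p q :
  kron_sum (p + q) p = (\sum_(I1 : ksub n p) \sum_(J1 : ksub n p)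
    \sum_(I2 : ksub n q) \sum_(J2 : ksub n q)
     (phi1 (\det (mxsub (kidx I1) (kidx J1) Y))
      * phi2 (\det (mxsub (kidx I2) (kidx J2) Z)))
     *~ kron (catidx I1 I2) (catidx J1 J2)) *+ (p`! * q`!).
Proof.
pose T (f1 g1 : {ffun 'I_p -> 'I_n}) (f2 g2 : {ffun 'I_q -> 'I_n}) :=
  (phi1 (\prod_a Y (f1 a) (g1 a)) * phi2 (\prod_a Z (f2 a) (g2 a)))
  *~ kron (fcat f1 f2) (fcat g1 g2).
have T0 (f1 g1 : {ffun 'I_p -> 'I_n}) (f2 g2 : {ffun 'I_q -> 'I_n}) :
    ~~ (injectiveb f1 && injectiveb f2 && (injectiveb g1 && injectiveb g2)) ->
    T f1 g1 f2 g2 = 0.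
  rewrite /T negb_and => /orP[] /fcat_noninj nf; last rewrite kronC;
    by rewrite kron_noninj.
have -> : kron_sum (p + q) p = \sum_f1 \sum_g1 \sum_f2 \sum_g2 T f1 g1 f2 g2.
  rewrite /kron_sum sum_ffun_split; apply: eq_bigr => f1 _.
  rewrite [RHS]exchange_big /=; apply: eq_bigr => f2 _.
  rewrite sum_ffun_split; apply: eq_bigr => g1 _; apply: eq_bigr => g2 _.
  rewrite /T; congr (phi1 _ * phi2 _ *~ _).
  - rewrite big_split_ord /= [X in _ * X]big1 ?mulr1 => [|a]; last first.
      by rewrite ltnNge leq_addr.
    by apply: eq_big => [a|a _]; rewrite ?ltn_ord // !ffunE !fcat_lshift.
  - rewrite big_split_ord /= [X in X * _]big1 ?mul1r => [|a]; last first.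
      by rewrite leqNgt ltn_ord.
    by apply: eq_big => [a|a _]; rewrite ?leq_addr // !ffunE !fcat_rshift.
  - by apply: eq_kron => a; rewrite ffunE.
rewrite sum_ffun_ksub2 => [|f1 g1 nfg]; last first.
  apply: big1 => f2 _; apply: big1 => g2 _; apply: T0; apply: contra nfg.
  by case/andP => /andP[-> _] /andP[-> _].
rewrite -sumrMnl; apply: eq_bigr => I1 _; rewrite -sumrMnl; apply: eq_bigr => J1 _.
have split2 f1 g1 : \sum_f2 \sum_g2 T f1 g1 f2 g2 = \sum_(I2 : ksub n q) \sum_(J2 : ksub n q)
    \sum_(s : 'S_q) \sum_(t : 'S_q)
      T f1 g1 [ffun a => kidx I2 (s a)] [ffun a => kidx J2 (t a)].
  rewrite sum_ffun_ksub2 // => f2 g2 nfg; apply: T0; apply: contra nfg.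
  by case/andP => /andP[_ ->] /andP[_ ->].
under eq_bigr do under eq_bigr do rewrite split2.
under eq_bigr do rewrite exchange_big /=.
rewrite exchange_big -sumrMnl; apply: eq_bigr => I2 _ /=.
under eq_bigr do rewrite exchange_big /=.
rewrite exchange_big -sumrMnl; apply: eq_bigr => J2 _ /=.
have phiE (U : comNzRingType) (phi : {additive U -> V}) k (A : 'M[U]_n) (I J : ksub n k) :
    phi (\det (mxsub (kidx I) (kidx J) A)) *+ k`! =
    \sum_(s : 'S_k) \sum_(t : 'S_k)
      phi (\prod_a A (kidx I (s a)) (kidx J (t a))) *~ ((-1) ^+ s * (-1) ^+ t).
  rewrite -raddfMn -sum_det_perm2 raddf_sum; apply: eq_bigr => s _ /=.
  rewrite raddf_sum; apply: eq_bigr => t _ /=; rewrite raddfMz; congr (phi _ *~ _).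
  by apply: eq_bigr => a _; rewrite mxE.
rewrite [in RHS]pmulrn mulrzAC -pmulrn mulrnA -mulrnAl -mulrnAr !phiE.
rewrite mulr_suml mulrz_suml; apply: eq_bigr => s1 _.
rewrite mulr_suml mulrz_suml; apply: eq_bigr => t1 _.
rewrite mulr_sumr mulrz_suml; apply: eq_bigr => s2 _.
rewrite mulr_sumr mulrz_suml; apply: eq_bigr => t2 _.
rewrite mulrzAl mulrzAr -!mulrzA /T; congr (phi1 _ * phi2 _ *~ _).
- by apply: eq_bigr => a _; rewrite !ffunE.
- by apply: eq_bigr => a _; rewrite !ffunE.
transitivity (kron (fcat (kidx I1 \o s1) (kidx I2 \o s2)) (fcat (kidx J1 \o t1) (kidx J2 \o t2))).
  by apply: eq_kron => a; rewrite /fcat; case: split => b; rewrite !ffunE.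
rewrite kron_fcat_perm kronC kron_fcat_perm kronC.
rewrite -[kron (catidx _ _) _]/(kron (fcat (kidx I1) (kidx I2)) (fcat (kidx J1) (kidx J2))).
by rewrite mulrA [RHS]mulrA; congr (_ * _); rewrite mulrACA mulrC.
Qed.

(* The image under D of the summand of kron_sum for (f, g), restricted to the
   derivative of the factor Y (f a) (g a); the inner sum is the commutator of the
   normally ordered product with L(E_{g a, f a}). *)
Definition kw_term m p (f g : 'I_m -> 'I_n) (a : 'I_m) : V :=
  phi1 (\prod_(b : 'I_m | (b < p)%N && (b != a)) Y (f b) (g b))
  * phi2 (\prod_(b : 'I_m | (p <= b)%N) Z (f b) (g b) * Z (f a) (g a)
      + \sum_(c : 'I_m | (p <= c)%N)
          (\prod_(b : 'I_m | (p <= b)%N && (b != c)) Z (f b) (g b) * Z (f a) (g c))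
          *+ (f c == g a)).

(** Each of the p+1 y-slots [a] contributes a normally ordered term [T1 a] and, for each of the m -
    p Z-slots [c], a commutator term [T2 a c]; the values do not depend on the slots. *)
Lemma kron_sum_kw m p : (p <= m)%N ->
  \sum_(f : {ffun 'I_m.+1 -> 'I_n}) \sum_(g : {ffun 'I_m.+1 -> 'I_n})
    (\sum_(a : 'I_m.+1 | (a < p.+1)%N) kw_term p.+1 f g a) *~ kron f g
  = (kron_sum m.+1 p - kron_sum m p *+ ((m - p) * (n - m))) *+ p.+1.
Proof.
move=> le_pm.
have swap_sum (F : {ffun 'I_m.+1 -> 'I_n} -> V) (t : 'S_m.+1) :
    \sum_f F f = \sum_(f : {ffun 'I_m.+1 -> 'I_n}) F [ffun a => f (t a)].
  rewrite (reindex (fun f : {ffun 'I_m.+1 -> 'I_n} => [ffun a => f (t a)])) //.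
  exists (fun f : {ffun 'I_m.+1 -> 'I_n} => [ffun a => f (t^-1 a)%g]) => f _;
    by apply/ffunP => a; rewrite !ffunE ?permK ?permKV.
pose T1 (a : 'I_m.+1) := \sum_(f : {ffun 'I_m.+1 -> 'I_n}) \sum_(g : {ffun 'I_m.+1 -> 'I_n})
  (phi1 (\prod_(b : 'I_m.+1 | (b < p.+1)%N && (b != a)) Y (f b) (g b))
   * phi2 (\prod_(b : 'I_m.+1 | (p < b)%N) Z (f b) (g b) * Z (f a) (g a))) *~ kron f g.
pose T2 (a c : 'I_m.+1) := \sum_(f : {ffun 'I_m.+1 -> 'I_n}) \sum_(g : {ffun 'I_m.+1 -> 'I_n})
  (phi1 (\prod_(b : 'I_m.+1 | (b < p.+1)%N && (b != a)) Y (f b) (g b))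
   * phi2 ((\prod_(b : 'I_m.+1 | (p < b)%N && (b != c)) Z (f b) (g b) * Z (f a) (g c))
          *+ (f c == g a))) *~ kron f g.
have ne (a b : 'I_m.+1) : (a < p.+1)%N -> (p < b)%N -> b != a.
  by move=> lt_ap lt_pb; apply: contraTneq lt_pb => ->; rewrite -leqNgt -ltnS.
(* Transposing the slots [a] and [p] in both [f] and [g] preserves [kron] and puts the new Z-slot
   next to the old ones. *)
have T1E (a : 'I_m.+1) : (a < p.+1)%N -> T1 a = kron_sum m.+1 p.
  move=> lt_ap; have lt_pm : (p < m.+1)%N by [].
  pose h := Ordinal lt_pm.
  rewrite /T1 (swap_sum _ (tperm a h)); apply: eq_bigr => f _.
  rewrite (swap_sum _ (tperm a h)); apply: eq_bigr => g _.
  have -> : kron [ffun b => f (tperm a h b)] [ffun b => g (tperm a h b)] = kron f g.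
    transitivity (kron (f \o tperm a h) (g \o tperm a h)).
      by apply: eq_kron => b; rewrite ffunE.
    by rewrite kron_perm kronC kron_perm kronC mulrA -signr_addb addbb mul1r.
  congr (phi1 _ * phi2 _ *~ _).
    rewrite (reindex_inj (@perm_inj _ (tperm a h))) /=.
    apply: eq_big => [b|b _]; last by rewrite !ffunE tpermK.
    rewrite -[X in _ != X](tpermR a h) (inj_eq perm_inj).
    case: tpermP => [->|->|/eqP ba /eqP bh].
    - by rewrite ltnSn /= [RHS]ltn_neqAle -ltnS lt_ap andbT.
    - by rewrite eqxx andbF ltnn.
    - by rewrite [RHS]ltn_neqAle ltnS andbC.
  rewrite [RHS](bigD1 h) //= mulrC; congr (Z _ _ * _).
  - by rewrite ffunE tpermL.
  - by rewrite ffunE tpermL.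
  apply: eq_big => [b|b lt_pb]; first by rewrite ltn_neqAle andbC eq_sym.
  rewrite !ffunE tpermD // eq_sym ?(ne a) //.
  by apply: contraTneq lt_pb => ->; rewrite ltnn.
have T2E (a c : 'I_m.+1) : (a < p.+1)%N -> (p < c)%N -> T2 a c = - (kron_sum m p *+ (n - m)).
  move=> lt_ap lt_pc; have ac : a != c by rewrite eq_sym ne.
  (* After exchanging f a and f c the condition f c = g a becomes f a = g a. *)
  rewrite /T2 (swap_sum _ (tperm a c)).
  pose S (f g : {ffun 'I_m.+1 -> 'I_n}) :=
    (phi1 (\prod_(b : 'I_m.+1 | (b < p.+1)%N && (b != a)) Y (f b) (g b))
     * phi2 (\prod_(b : 'I_m.+1 | (p < b)%N) Z (f b) (g b))) *+ (f a == g a).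
  transitivity (- \sum_f \sum_g S f g *~ kron f g).
    rewrite -sumrN; apply: eq_bigr => f _; rewrite -sumrN; apply: eq_bigr => g _.
    have -> : kron [ffun b => f (tperm a c b)] g = - kron f g.
      transitivity (kron (f \o tperm a c) g).
        by apply: eq_kron => b; rewrite ?ffunE.
      by rewrite kron_perm odd_tperm ac expr1 mulN1r.
    rewrite mulrNz /S; congr (- (_ *~ _)); rewrite raddfMn mulrnAr /= !ffunE tpermL tpermR.
    congr (phi1 _ * phi2 _ *+ _).
      apply: eq_bigr => b /andP[lt_bp ba]; rewrite ffunE tpermD // eq_sym //.
      by apply: contraTneq lt_bp => ->; rewrite -leqNgt.
    rewrite [RHS](bigD1 c) //= mulrC; congr (_ * _).
    apply: eq_bigr => b /andP[lt_pb bc]; rewrite ffunE tpermD // eq_sym //.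
    by apply: contraTneq lt_pb => ->; rewrite -leqNgt -ltnS.
  (* Slot [a] no longer carries a factor, and both functions take the same value [i] there, so the
     sum over [i] contracts [kron] at that slot. *)
  congr (- _); rewrite (sum_ffun_insert a) exchange_big /= /kron_sum.
  rewrite -sumrMnl; apply: eq_bigr => f _.
  transitivity (\sum_i \sum_(g : {ffun 'I_m -> 'I_n})
      (phi1 (\prod_(b : 'I_m | (b < p)%N) Y (f b) (g b))
       * phi2 (\prod_(b : 'I_m | (p <= b)%N) Z (f b) (g b)))
      *~ kron (insert_at a i f) (insert_at a i g)).
    apply: eq_bigr => i _; rewrite (sum_ffun_insert a) (bigD1 i) //=.
    rewrite [X in _ + X]big1 ?addr0 => [|j ji]; last first.
      by apply: big1 => g _; rewrite /S !ffunE !insert_atE eq_sym (negPf ji) mulr0n mul0rz.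
    apply: eq_bigr => g _; rewrite /S !ffunE !insert_atE eqxx mulr1n.
    (* Since a <= p, deleting slot [a] moves the border between y-slots and Z-slots from p+1 to
       p. *)
    congr (phi1 _ * phi2 _ *~ _).
    - rewrite (big_lift _ a) /=; apply: eq_big => [b|b _]; last by rewrite !ffunE !insert_at_lift.
      rewrite /= /bump; case: (leqP a b) => [le_ab|lt_ba]; first by rewrite ?add1n ?ltnS.
      have lt_bp : (b < p)%N := leq_trans lt_ba lt_ap.
      by rewrite add0n lt_bp; apply: ltnW.
    - have -> : \prod_(b : 'I_m.+1 | (p < b)%N)
            Z ([ffun b => insert_at a i f b] b) ([ffun b => insert_at a i g b] b)
          = \prod_(b : 'I_m.+1 | (p < b)%N && (b != a))
            Z ([ffun b => insert_at a i f b] b) ([ffun b => insert_at a i g b] b).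
        by apply: eq_bigl => b; rewrite andb_idr //; apply: ne.
      rewrite (big_lift _ a) /=; apply: eq_big => [b|b _]; last by rewrite !ffunE !insert_at_lift.
      rewrite /= /bump; case: (leqP a b) => [le_ab|lt_ba]; first by rewrite ?add1n ?ltnS.
      rewrite add0n ltnNge (leq_trans (ltnW lt_ba)) // leqNgt.
      by rewrite (leq_trans lt_ba).
    - by apply: eq_kron => b; rewrite ffunE.
  rewrite exchange_big -sumrMnl; apply: eq_bigr => g _ /=.
  by rewrite -mulrz_sumr kron_contract -mulr_natr mulrzA natz -pmulrn.
transitivity (\sum_(a : 'I_m.+1 | (a < p.+1)%N) (T1 a + \sum_(c : 'I_m.+1 | (p < c)%N) T2 a c)).
  rewrite /T1 /T2; under [RHS]eq_bigr do rewrite [X in _ + X]exchange_big -big_split /=.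
  rewrite [RHS]exchange_big /=; apply: eq_bigr => f _.
  under [RHS]eq_bigr do rewrite [X in _ + X]exchange_big /=.
  under [RHS]eq_bigr do rewrite -big_split /=.
  rewrite [RHS]exchange_big /=; apply: eq_bigr => g _.
  rewrite mulrz_suml; apply: eq_bigr => a _.
  rewrite /kw_term raddfD mulrDr mulrzDl; congr (_ + _).
  by rewrite (raddf_sum phi2) mulr_sumr mulrz_suml.
have card_lt : #|[pred a : 'I_m.+1 | (a < p.+1)%N]| = p.+1.
  by rewrite -sum1_card -(big_ord_widen _ (fun=> 1%N)) ?sum1_card ?card_ord // ltnS.
have card_gt : #|[pred c : 'I_m.+1 | (p < c)%N]| = (m - p)%N.
  have := cardC [pred a : 'I_m.+1 | (a < p.+1)%N]; rewrite card_lt card_ord => eqm.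
  rewrite -[RHS]subSS -[in RHS]eqm addKn -!sum1_card; apply: eq_bigl => c.
  by rewrite !inE -leqNgt.
under eq_bigr => a lt_a.
  rewrite T1E // (eq_bigr (fun=> - (kron_sum m p *+ (n - m)))) => [|c lt_pc]; last exact: T2E.
  rewrite sumr_const card_gt mulNrn -mulrnA mulnC.
  over.
by rewrite sumr_const card_lt.
Qed.

End KronSums.

(** * Derivatives, evaluation and induction for multivariate polynomials *)

Lemma mderiv_prod (R : comNzRingType) (N : nat) (k : 'I_N) (I : finType) (P : pred I)
    (F : I -> {mpoly R[N]}) :
  mderiv k (\prod_(i | P i) F i)
  = \sum_(i | P i) \prod_(j | P j && (j != i)) F j * mderiv k (F i).
Proof.
(* The list is duplicate-free so that [j != i] removes exactly one factor. *)
have E (s : seq I) : uniq s ->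
    mderiv k (\prod_(i <- s | P i) F i)
    = \sum_(i <- s | P i) \prod_(j <- s | P j && (j != i)) F j * mderiv k (F i).
  elim: s => [|a s IH] /=; first by rewrite !big_nil -mpolyC1 mderivC.
  case/andP => as_ /IH {}IH; rewrite !big_cons.
  have aE : \prod_(j <- s | P j && (j != a)) F j = \prod_(j <- s | P j) F j.
    rewrite big_seq_cond [RHS]big_seq_cond; apply: eq_bigl => j.
    by case: eqP => [->|_]; rewrite ?(negPf as_) ?andbT.
  have cE : \sum_(i <- s | P i) \prod_(j <- a :: s | P j && (j != i)) F j * mderiv k (F i)
      = (if P a then F a else 1) * mderiv k (\prod_(i <- s | P i) F i).
    rewrite IH mulr_sumr [LHS]big_seq_cond [RHS]big_seq_cond; apply: eq_bigr => i /andP[is_ _].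
    rewrite big_cons; have -> : a != i by apply: contraNneq as_ => ->.
    by rewrite andbT; case: (P a); rewrite ?mul1r ?mulrA.
  case: (boolP (P a)) cE => Pa cE; last by rewrite cE mul1r.
  by rewrite mderivM cE ?Pa eqxx /= aE mulrC.
by apply: E; apply: index_enum_uniq.
Qed.

Lemma mderiv_mpolyXU (R : nzRingType) (N : nat) (k l : 'I_N) :
  mderiv k ('X_l : {mpoly R[N]}) = (k == l)%:R.
Proof.
rewrite mderivX mnm1E eq_sym; case: eqP => [->|_]; last by rewrite scale0r.
rewrite scale1r (_ : (_ - _)%MM = 0%MM) ?mpolyX0 //.
by apply/mnmP => i; rewrite mnmBE subnn mnm0E.
Qed.

Lemma mderiv_map_mpoly (R S : nzRingType) (h : {rmorphism R -> S}) (N : nat) (k : 'I_N)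
    (p : {mpoly R[N]}) :
  mderiv k (map_mpoly h p) = map_mpoly h (mderiv k p).
Proof.
elim/mpolyind: p => [|c m p _ _ IH]; first by rewrite !raddf0.
rewrite !raddfD /= IH; congr (_ + _).
by rewrite map_mpolyZ map_mpolyX !mderivZ map_mpolyZ !mderivX map_mpolyZ map_mpolyX rmorph_nat.
Qed.

Lemma mmap1DU (S : nzRingType) (N : nat) (h : 'I_N -> S) (m : 'X_{1..N}) k :
  (forall i j, GRing.comm (h i) (h j)) -> mmap1 h (m + U_(k))%MM = mmap1 h m * h k.
Proof.
move=> hC; rewrite -[in RHS](mmap1U h k) /mmap1.
(* The invariant keeps the partial product [x] commuting with every [h i], so that a power of [h i]
   can be moved past it. *)
pose Q (x y z : S) := z = x * y /\ forall i, GRing.comm (h i) x.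
suff [-> _] : Q (\prod_i h i ^+ m i) (\prod_i h i ^+ U_(k)%MM i)
  (\prod_i h i ^+ (m + U_(k))%MM i) by [].
apply: (big_rec3 Q) => [|i x y z _ [-> xC]].
  by split=> [|i]; rewrite ?mulr1 //; apply: commr1.
split=> [|j]; last by apply: commrM => //; apply/commrX/hC.
rewrite mnmDE exprD -!mulrA; congr (_ * _); rewrite !mulrA; congr (_ * _).
exact/commr_sym/commrX/commr_sym.
Qed.

(** Monomials are built by appending variables on the right, the side on which [normal_order]
    appends derivations. *)
Lemma mpoly_indMX (R : nzRingType) (N : nat) (Q : {mpoly R[N]} -> Prop) :
  (forall c, Q c%:MP) -> (forall p q, Q p -> Q q -> Q (p + q)) ->
  (forall p k, Q p -> Q (p * 'X_k)) -> forall p, Q p.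
Proof.
move=> QC QD QX p; elim/mpolyind: p => [|c m p _ _ Qp]; first by rewrite -mpolyC0.
apply: QD => {Qp p} //; rewrite -mul_mpolyC mpolyXE_id.
pose Q' u := forall w, Q w -> Q (w * u).
suff: Q' (\prod_i 'X_i ^+ m i) by apply; apply: QC.
apply: (big_ind Q') => [w|u v Qu Qv w Qw|i _]; first by rewrite mulr1.
  by rewrite mulrA; apply/Qv/Qu.
elim: (m i) => [|e IH] w Qw; first by rewrite mulr1.
by rewrite exprS mulrA; apply/IH/QX.
Qed.

(** * Normal ordering *)

Section NormalOrder.
Context (K : numFieldType) (n r : nat).
Notation P := {mpoly K[n * r]}.
Notation EndP := (endo K (n * r)).
Notation W := {mpoly P[n * r]}.

Fact mulop_is_zmod_morphism : zmod_morphism (@mulop K (n * r)).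
Proof. by move=> p q; apply: endoP => t; rewrite /= mulrBl. Qed.
HB.instance Definition _ :=
  GRing.isZmodMorphism.Build P EndP (@mulop K (n * r)) mulop_is_zmod_morphism.

Fact mulop_is_monoid_morphism : monoid_morphism (@mulop K (n * r)).
Proof. by split=> [|p q]; apply: endoP => t; rewrite /= ?mul1r // mulrA. Qed.
HB.instance Definition _ :=
  GRing.isMonoidMorphism.Build P EndP (@mulop K (n * r)) mulop_is_monoid_morphism.

Definition derop (k : 'I_(n * r)) : EndP := Endo (mderiv k).

Lemma deropC i j : GRing.comm (derop i) (derop j).
Proof. by apply: endoP => p; apply: mderiv_comm. Qed.

Lemma derop_mulX k l : derop k * mulop 'X_l = mulop 'X_l * derop k + (k == l)%:R.
Proof.
apply: endoP => p; rewrite [RHS]endoDE [LHS]mderivM mderiv_mpolyXU addrC.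
by congr (_ + _); case: eqP => _; rewrite ?mul1r ?mul0r.
Qed.

(* A symbol is a polynomial in the commuting dual variables of the derivations,
   with coefficients in P acting by multiplication from the left. *)
Definition normal_order (w : W) : EndP := mmap (@mulop K (n * r)) derop w.
HB.instance Definition _ := GRing.Additive.copy normal_order (mmap (@mulop K (n * r)) derop).

Lemma normal_orderC c : normal_order c%:MP = mulop c.
Proof. exact: mmapC. Qed.

Lemma normal_orderCM c w : normal_order (c%:MP * w) = mulop c * normal_order w.
Proof. by rewrite mul_mpolyC; apply: mmapZ. Qed.

Lemma normal_orderMX w k : normal_order (w * 'X_k) = normal_order w * derop k.
Proof.
elim/mpolyind: w => [|c m w _ _ IH]; first by rewrite mul0r raddf0 mul0r.
rewrite mulrDl !raddfD /= mulrDl IH; congr (_ + _).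
rewrite -scalerAl -mpolyXD /normal_order !mmapZ !mmapX mmap1DU ?mulrA //.
exact: deropC.
Qed.

(** Moving x_k to the left across the derivations costs, by the Weyl relation [derop_mulX], one
    derivative of the symbol in the dual variable. The induction peels off the rightmost
    derivation. *)
Lemma normal_orderM_mulX w k :
  normal_order w * mulop 'X_k = normal_order (w * ('X_k)%:MP + mderiv k w).
Proof.
elim/mpoly_indMX: w => [c|p q IHp IHq|w l IH].
- by rewrite mderivC addr0 -mpolyCM !normal_orderC rmorphM.
- by rewrite raddfD mulrDl /= IHp IHq -raddfD /= mulrDl mderivD addrACA.
rewrite normal_orderMX -mulrA derop_mulX mulrDr mulrA IH -normal_orderMX.
rewrite mulr_natr -raddfMn -raddfD /=; congr normal_order.
rewrite mulrDl mderivM mderiv_mpolyXU [k == l]eq_sym mulr_natr addrA; congr (_ + _ + _).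
by rewrite mulrAC.
Qed.

Definition symD : 'M[W]_(n, r) := \matrix_(i, a) 'X_(mxvec_index i a).
Definition symX : 'M[W]_(n, r) := map_mx (@mpolyC (n * r) P) (varX K n r).
(** The matrix Z of the overview. Its index order makes an I, J minor expand into minors of D with
    rows I and of X with rows J, as in [Fpq]. *)
Definition symL : 'M[W]_n := symD *m symX^T.

Lemma normal_orderM_actL w i j :
  normal_order w * actL K r i j
  = normal_order (w * symL j i + \sum_a mderiv (mxvec_index i a) w * symD j a).
Proof.
rewrite /actL mulr_sumr [symL j i]mxE mulr_sumr -big_split raddf_sum.
apply: eq_bigr => a _; rewrite mulrA !mxE normal_orderM_mulX -[Endo _]/(derop _).
by rewrite -normal_orderMX mulrDl -mulrA [_%:MP * _]mulrC.
Qed.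

Lemma mderiv_symL i a j l :
  mderiv (mxvec_index i a) (symL j l) = (j == i)%:R * symX l a.
Proof.
rewrite [symL j l]mxE raddf_sum (bigD1 a) //= [X in _ + X]big1 ?addr0 => [|b ba].
  by rewrite !mxE mderivM mderivC mulr0 addr0 mderiv_mpolyXU mxvec_index_eq eqxx andbT eq_sym.
rewrite !mxE mderivM mderivC mulr0 addr0 mderiv_mpolyXU mxvec_index_eq.
by rewrite [a == b]eq_sym (negPf ba) andbF mul0r.
Qed.

(** The correction in [normal_orderM_actL] is a derivation of the symbol: it sends Z_kl to Z_jl if k
    = i and to 0 otherwise, so the product rule gives one term per factor. *)
Lemma normal_order_prod_actL m (Q : pred 'I_m) (f g : 'I_m -> 'I_n) i j :
  normal_order (\prod_(b | Q b) symL (f b) (g b)) * actL K r i j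
  = normal_order (\prod_(b | Q b) symL (f b) (g b) * symL j i
     + \sum_(c | Q c) (\prod_(b | Q b && (b != c)) symL (f b) (g b) * symL j (g c))
                      *+ (f c == i)).
Proof.
rewrite normal_orderM_actL; congr (normal_order (_ + _)).
transitivity (\sum_a \sum_(c | Q c) (\prod_(b | Q b && (b != c)) symL (f b) (g b)
    * mderiv (mxvec_index i a) (symL (f c) (g c))) * symD j a).
  by apply: eq_bigr => a _; rewrite mderiv_prod mulr_suml.
rewrite exchange_big; apply: eq_bigr => c _ /=.
under eq_bigr do rewrite mderiv_symL mulr_natl mulrnAr mulrnAl -mulrA [symX _ _ * _]mulrC.
rewrite sumrMnl -mulr_sumr; congr (_ * _ *+ _).
by rewrite [RHS]mxE; apply: eq_bigr => a _; rewrite [symX^T _ _]mxE.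
Qed.

(** The minor in X consists of coefficients, which already stand on the left, and the derivations
    are appended one by one; no commutator arises. *)
Lemma normal_order_det q (I J : 'I_q -> 'I_n) (R : 'I_q -> 'I_r) :
  normal_order (\det (mxsub J R symX) * \det (mxsub I R symD))
  = \det (mxsub J R (opX K n r)) * \det (mxsub I R (opD K n r)).
Proof.
have -> : mxsub J R symX = map_mx (@mpolyC (n * r) P) (mxsub J R (varX K n r)).
  by apply/matrixP => a b; rewrite !mxE.
have -> : mxsub J R (opX K n r) = map_mx (@mulop K (n * r)) (mxsub J R (varX K n r)).
  by apply/matrixP => a b; rewrite !mxE.
rewrite det_map_mx normal_orderCM; congr (_ * _).
  rewrite /determinant raddf_sum; apply: eq_bigr => s _ /=.
  rewrite rmorphM rmorph_sign rmorph_prod; congr (_ * _).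
  by apply: eq_bigr => a _; rewrite [RHS]mxE.
rewrite /determinant raddf_sum; apply: eq_bigr => s _ /=.
rewrite !mulr_sign (fun_if normal_order) raddfN /=.
suff -> : normal_order (\prod_a mxsub I R symD a (s a))
    = \prod_a mxsub I R (opD K n r) a (s a) by [].
have prodE (k : 'I_q -> 'I_(n * r)) : normal_order (\prod_a 'X_(k a)) = \prod_a derop (k a).
  elim: q {I J R s} k => [|q IH] k.
    by rewrite !big_ord0 -mpolyC1 normal_orderC rmorph1.
  by rewrite !big_ord_recr /= normal_orderMX IH.
under eq_bigr do rewrite !mxE.
by rewrite prodE; apply: eq_bigr => a _; rewrite !mxE.
Qed.

End NormalOrder.

(** * The Cauchy-Binet formula, and the sign of two splittings as a Kronecker delta *)

Lemma Cauchy_Binet (S : comNzRingType) q r (A : 'M[S]_(q, r)) (B : 'M[S]_(r, q)) :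
  \det (A *m B) =
  \sum_(R : ksub r q) \det (mxsub id (kidx R) A) * \det (mxsub (kidx R) id B).
Proof.
(* Expansion over all maps [h]: a repeated value gives two equal rows, and the injective maps are
   then regrouped by their image. *)
transitivity (\sum_(h : {ffun 'I_q -> 'I_r}) (\prod_a A a (h a)) * \det (mxsub h id B)).
  rewrite /determinant; under [RHS]eq_bigr do rewrite mulr_sumr.
  rewrite [RHS]exchange_big; apply: eq_bigr => s _ /=.
  under eq_bigr do rewrite mxE.
  rewrite bigA_distr_bigA mulr_sumr; apply: eq_bigr => h _ /=.
  rewrite mulrCA big_split; congr (_ * (_ * _)).
  by apply: eq_bigr => a _; rewrite mxE.
rewrite sum_ffun_ksub => [|h /injectivePn[a [b ab eh]]]; last first.
  by rewrite (determinant_alternate ab) ?mulr0 // => c; rewrite !mxE eh.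
apply: eq_bigr => R _; rewrite [X in _ = X * _]/determinant mulr_suml; apply: eq_bigr => s _.
have -> : mxsub [ffun a => kidx R (s a)] id B = row_perm s (mxsub (kidx R) id B).
  by apply/matrixP => a b; rewrite !mxE ffunE.
rewrite row_permE det_mulmx det_perm mulrA [_ * (-1) ^+ s]mulrC; congr (_ * _ * _).
by apply: eq_bigr => a _; rewrite mxE ffunE.
Qed.

Section SignIndex.
Context (n p q : nat).

Lemma catidx_imset (I1 : ksub n p) (I2 : ksub n q) :
  [set catidx I1 I2 a | a : 'I_(p + q)] = val I1 :|: val I2.
Proof.
rewrite -!kidx_imset; apply/setP=> i; rewrite inE; apply/imsetP/orP.
  case=> a _ ->; rewrite /catidx; case: split => b; [left|right]; exact: imset_f.
case=> /imsetP[b _ ->]; [exists (lshift q b)|exists (rshift p b)] => //.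
  by rewrite [RHS]fcat_lshift.
by rewrite [RHS]fcat_rshift.
Qed.

Lemma catidx_injectiveb (I1 : ksub n p) (I2 : ksub n q) :
  injectiveb (catidx I1 I2) = [disjoint val I1 & val I2].
Proof.
transitivity (#|val I1 :|: val I2| == p + q)%N.
  rewrite -catidx_imset; apply/injectiveP/idP => [inj|].
    by rewrite card_imset // card_ord.
  rewrite -[X in _ == X](card_ord (p + q)) => /imset_injP inj a b.
  exact: inj.
have cE := cardsUI (val I1) (val I2); rewrite (eqP (valP I1)) (eqP (valP I2)) in cE.
by rewrite -setI_eq0 -cards_eq0 -cE -{1}[#|_ :|: _|]addn0 eqn_add2l eq_sym.
Qed.

(** If both tuples are injective, at most one permutation survives in the Leibniz expansion, the one
    picked in [sgn_idx]. A repeated index gives two equal rows or columns. *)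
Lemma kron_catidx (I1 J1 : ksub n p) (I2 J2 : ksub n q) :
  kron (catidx I1 I2) (catidx J1 J2) =
  if [&& [disjoint val I1 & val I2], [disjoint val J1 & val J2]
      & val I1 :|: val I2 == val J1 :|: val J2]
  then sgn_idx I1 I2 J1 J2 else 0.
Proof.
rewrite -!catidx_injectiveb.
have [injI|ninj] := boolP (injectiveb (catidx I1 I2)); last by rewrite kron_noninj.
have [injJ|ninj] := boolP (injectiveb (catidx J1 J2)); last by rewrite kronC kron_noninj.
(* With the arguments exchanged, the Leibniz term of [s] tests whether entry a of J1 J2 is entry
   s(a) of I1 I2, the convention of [sgn_idx]. *)
rewrite kronC /= /kron /determinant.
pose Q (s : 'S_(p + q)) := [forall a, catidx I1 I2 (s a) == catidx J1 J2 a].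
rewrite (bigID Q) /= [X in _ + X]big1 ?addr0 => [|s]; last first.
  rewrite negb_forall => /existsP[a ne]; rewrite (bigD1 a) //= mxE eq_sym.
  by rewrite (negPf ne) mul0r mulr0.
rewrite (eq_bigr (fun s : 'S_(p + q) => (-1) ^+ s)) => [|s /forallP Qs]; last first.
  by rewrite big1 ?mulr1 // => a _; rewrite mxE eq_sym Qs.
rewrite /sgn_idx -/(Q _); case: pickP => [s Qs|Q0]; last first.
  by rewrite big_pred0 // if_same.
have Qimset : [set catidx I1 I2 a | a : 'I_(p + q)] = [set catidx J1 J2 a | a : 'I_(p + q)].
  apply/setP=> i; apply/imsetP/imsetP => -[a _ ->].
    by exists (s^-1 a)%g => //; have /eqP<- := forallP Qs (s^-1 a)%g; rewrite permKV.
  by exists (s a) => //; apply/esym/eqP/(forallP Qs).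
rewrite -!catidx_imset Qimset eqxx (big_pred1 s) // => t; apply/idP/eqP => [Qt|->//].
apply/permP => a; apply: (injectiveP _ injI).
by rewrite (eqP (forallP Qt a)) (eqP (forallP Qs a)).
Qed.

End SignIndex.

(** * The action of the Kirillov-Wei operator on [Fpq] *)

Section KirillovWei.
Context {K : numFieldType} {n r : nat}.
Notation EndP := (endo K (n * r)).
Notation polymap := (polymap K n r).
Notation W := {mpoly {mpoly K[n * r]}[n * r]}.

Fact KWop_is_zmod_morphism : zmod_morphism (@KWop K n r).
Proof.
move=> F G; rewrite /KWop -sumrB; apply: eq_bigr => i _; rewrite -sumrB.
by apply: eq_bigr => j _; rewrite raddfB mulrBl.
Qed.
HB.instance Definition _ :=
  GRing.isZmodMorphism.Build polymap polymap (@KWop K n r) KWop_is_zmod_morphism.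

Definition scalar_map : {mpoly K[n * n]} -> polymap := map_mpoly (in_alg EndP).
HB.instance Definition _ := GRing.RMorphism.copy scalar_map (map_mpoly (in_alg EndP)).

Definition const_symbol (w : W) : polymap := cst (normal_order w).
Fact const_symbol_is_zmod_morphism : zmod_morphism const_symbol.
Proof. by move=> v w; rewrite /const_symbol /cst !raddfB. Qed.
HB.instance Definition _ :=
  GRing.isZmodMorphism.Build W polymap const_symbol const_symbol_is_zmod_morphism.

Definition genY : 'M[{mpoly K[n * n]}]_n := \matrix_(i, j) 'X_(mxvec_index i j).

Notation symL := (symL K n r).
Notation kw_term := (kw_term scalar_map const_symbol genY symL).
Notation kron_sum := (kron_sum scalar_map const_symbol genY symL).

Lemma mderiv_scalar_map k P T :
  mderiv k (scalar_map P * cst T) = scalar_map (mderiv k P) * cst T.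
Proof.
rewrite mderivM mderivC [X in _ + X]mulr0 addr0.
by rewrite (mderiv_map_mpoly (in_alg EndP)).
Qed.

(** Differentiating the factor of slot [a] forces i = g a and j = f a, so a single L(E_{g a, f a})
    is composed with the normally ordered product. *)
Lemma KWop_term m p (f g : 'I_m -> 'I_n) :
  KWop (scalar_map (\prod_(b : 'I_m | (b < p)%N) genY (f b) (g b))
        * const_symbol (\prod_(b : 'I_m | (p <= b)%N) symL (f b) (g b)))
  = \sum_(a : 'I_m | (a < p)%N) kw_term p f g a.
Proof.
pose T := normal_order (\prod_(b : 'I_m | (p <= b)%N) symL (f b) (g b)).
rewrite -[const_symbol _]/(cst T) /KWop.
have E i j : mderiv (mxvec_index j i) (\prod_(b : 'I_m | (b < p)%N) genY (f b) (g b))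
   = \sum_(a : 'I_m | (a < p)%N)
      (\prod_(b : 'I_m | (b < p)%N && (b != a)) genY (f b) (g b)) *+ ((f a == j) && (g a == i)).
  rewrite mderiv_prod; apply: eq_bigr => a _.
  by rewrite mxE mderiv_mpolyXU mxvec_index_eq mulr_natr [j == _]eq_sym [i == _]eq_sym.
transitivity (\sum_i \sum_j \sum_(a : 'I_m | (a < p)%N)
   (scalar_map (\prod_(b : 'I_m | (b < p)%N && (b != a)) genY (f b) (g b))
     * cst (T * actL K r i j)) *+ ((f a == j) && (g a == i))).
  apply: eq_bigr => i _; apply: eq_bigr => j _.
  rewrite mderiv_scalar_map E (raddf_sum scalar_map) mulr_suml mulr_suml.
  apply: eq_bigr => a _.
  by rewrite (raddfMn scalar_map) /= !mulrnAl -mulrA /cst -mpolyCM.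
under eq_bigr do rewrite exchange_big.
rewrite exchange_big; apply: eq_bigr => a _ /=.
rewrite (bigD1 (g a)) //= (bigD1 (f a)) //= !eqxx.
rewrite [X in _ + X + _]big1 => [|j /negPf ne]; last by rewrite eq_sym ne.
rewrite [X in _ + X]big1 => [|i /negPf ne]; last first.
  by rewrite big1 // => j _; rewrite [g a == i]eq_sym ne andbF.
by rewrite !addr0 mulr1n /kw_term /const_symbol normal_order_prod_actL.
Qed.

Lemma KWop_kron_sum m p : (p <= m)%N ->
  KWop (kron_sum m.+1 p.+1)
  = (kron_sum m.+1 p - kron_sum m p *+ ((m - p) * (n - m))) *+ p.+1.
Proof.
move=> le_pm; rewrite -kron_sum_kw // /kron_sum raddf_sum.
apply: eq_bigr => f _; rewrite raddf_sum; apply: eq_bigr => g _.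
by rewrite raddfMz /= KWop_term.
Qed.

Lemma det_varY p (I J : ksub n p) :
  \det (mxsub (kidx I) (kidx J) (varY K n r))
  = scalar_map (\det (mxsub (kidx I) (kidx J) genY)).
Proof.
rewrite /determinant (raddf_sum scalar_map); apply: eq_bigr => s _ /=.
rewrite (rmorphM scalar_map) rmorph_sign rmorph_prod; congr (_ * _); apply: eq_bigr => a _.
by rewrite !mxE; apply/esym/map_mpolyX.
Qed.

(** Cauchy-Binet is applied to symbols, whose entries commute, and only then is the result normally
    ordered. *)
Lemma normal_order_det_symL q (I J : ksub n q) :
  \sum_(R : ksub r q) \det (mxsub (kidx J) (kidx R) (opX K n r))
                     * \det (mxsub (kidx I) (kidx R) (opD K n r))
  = normal_order (\det (mxsub (kidx I) (kidx J) symL)).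
Proof.
have -> : mxsub (kidx I) (kidx J) symL
    = mxsub (kidx I) id (symD K n r) *m mxsub id (kidx J) (symX K n r)^T.
  by apply/matrixP => a b; rewrite !mxE; apply: eq_bigr => c _; rewrite !mxE.
rewrite Cauchy_Binet raddf_sum; apply: eq_bigr => R _ /=.
have -> : mxsub (kidx R) id (mxsub id (kidx J) (symX K n r)^T)
    = (mxsub (kidx J) (kidx R) (symX K n r))^T.
  by apply/matrixP => a b; rewrite !mxE.
rewrite det_tr [X in normal_order X]mulrC -normal_order_det.
by rewrite -mxsub_comp.
Qed.

(** The side conditions on the subsets in [Fpq] are absorbed by [kron], which vanishes when they
    fail. *)
Lemma Fpq_kron_sum p q : Fpq K n r p q *+ (p`! * q`!) = kron_sum (p + q) p.
Proof.
rewrite kron_sum_ksub; congr (_ *+ _).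
apply: eq_bigr => I1 _; apply: eq_bigr => J1 _; apply: eq_bigr => I2 _.
rewrite big_mkcond; apply: eq_bigr => J2 _; rewrite kron_catidx.
case: ifP => [_|_]; last exact/esym/mulr0z.
by rewrite det_varY normal_order_det_symL.
Qed.

Lemma polymap_mulIrn k : (0 < k)%N -> injective (fun F : polymap => F *+ k).
Proof.
move=> k_gt0 F G /= e.
have H (H : polymap) : cst (k%:R^-1)%:A * (H *+ k) = H.
  rewrite mulrnAr -mulrnAl /cst -raddfMn /= -scaler_nat scalerA mulfV ?pnatr_eq0 -?lt0n //.
  by rewrite scale1r mpolyC1 mul1r.
by rewrite -[F]H e H.
Qed.

(** This is [KWop_kron_sum] at m = p + q; characteristic zero allows the common factor (p+1)! q! to
    be cancelled. *)
Lemma KWop_Fpq p q :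
  KWop (Fpq K n r p.+1 q)
  = Fpq K n r p q.+1 *+ q.+1 - Fpq K n r p q *+ (q * (n - (p + q))).
Proof.
apply: (@polymap_mulIrn (p.+1`! * q`!)); first by rewrite muln_gt0 !fact_gt0.
rewrite -raddfMn Fpq_kron_sum /= addSn KWop_kron_sum ?leq_addr // addKn.
rewrite -addnS -!Fpq_kron_sum.
rewrite !mulrnBl -!mulrnA; congr (_ *+ _ - _ *+ _); rewrite !factS; nia.
Qed.

End KirillovWei.

(** * The coefficients and their recurrence *)

Lemma stirling2E q l : stirling2 q l = stirling_rec q l.
Proof. by rewrite /stirling2 card_parts cardsT card_ord. Qed.

Section Coefficients.
Context (n : nat).

Definition coefM p q l : int :=
  (-1) ^+ (q - l) * ((q - l)`! * l`! * stirling2 q l * 'C(n - p - l, q - l))%:R.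

Lemma coefM_big p q : coefM p q q.+1 = 0.
Proof. by rewrite /coefM stirling2E stirling_rec_gt // muln0 mul0n mulr0. Qed.

Lemma coefM0 p q : coefM p q.+1 0 = 0.
Proof. by rewrite /coefM stirling2E muln0 mul0n mulr0. Qed.

Lemma coefMqq p q : coefM p q q = q`!%:R.
Proof. by rewrite /coefM stirling2E stirling_recnn subnn bin0 fact0 mul1r mul1n !muln1. Qed.

(** Combines S(q+1, l+1) = (l+1) S(q, l+1) + S(q, l) with N C(N-1, k) = (k+1) C(N, k+1), where N = n
    - p - 1 - l and k = q - l - 1. *)
Lemma coefMS p q l : (l <= q)%N ->
  coefM p q.+1 l.+1
  = coefM p.+1 q l * l.+1%:R - coefM p.+1 q l.+1 * (l.+1 * (n - (p + l.+1)))%:R.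
Proof.
move=> le_lq; rewrite /coefM !stirling2E subSS /= (_ : n - p - l.+1 = n - p.+1 - l)%N; last by lia.
rewrite (_ : n - (p + l.+1) = n - p.+1 - l)%N; last by lia.
rewrite (_ : n - p.+1 - l.+1 = (n - p.+1 - l).-1)%N; last by lia.
set N := (n - p.+1 - l)%N.
(* The case l = q stands apart because q - (l+1) is truncated there; the second term vanishes with
   S(q, q+1). *)
have [->|neq] := eqVneq l q.
  rewrite subnn !bin0 (stirling_rec_gt (ltnSn q)) !muln0 !mul0n mulr0 mul0r subr0.
  by rewrite expr0 factS; ring.
have -> : (q - l)%N = (q - l.+1).+1 by lia.
set k := (q - l.+1)%N.
have binE : (N * 'C(N.-1, k) = k.+1 * 'C(N, k.+1))%N by rewrite mul_bin_diag.
have {binE} e : N%:R * 'C(N.-1, k)%:R = k.+1%:R * 'C(N, k.+1)%:R :> int by rewrite -!natrM binE.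
rewrite exprS mulN1r !factS !natrM natrD natrM.
transitivity (- (-1) ^+ k * (k`!%:R * (l.+1%:R * l`!%:R)
    * (l.+1%:R * (stirling_rec q l.+1)%:R + (stirling_rec q l)%:R)
    * (k.+1%:R * 'C(N, k.+1)%:R)) : int).
  by ring.
transitivity (- (-1) ^+ k * (k`!%:R * l`!%:R * (stirling_rec q l)%:R
      * (k.+1%:R * 'C(N, k.+1)%:R)) * l.+1%:R
    - (-1) ^+ k * (k`!%:R * (l.+1%:R * l`!%:R) * (stirling_rec q l.+1)%:R
      * (N%:R * 'C(N.-1, k)%:R)) * l.+1%:R : int).
  by rewrite e; ring.
by ring.
Qed.

End Coefficients.

(** * Passing between the two families of generators *)

Section Generation.
Context {K : numFieldType} {n r : nat}.
Notation polymap := (polymap K n r).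
Notation Fpq := (Fpq K n r).

Definition ksub0 m : ksub m 0 := exist _ set0 (introT eqP (cards0 'I_m)).

Lemma ksub0P m (I : ksub m 0) : I = ksub0 m.
Proof. by apply: val_inj; apply/eqP; rewrite /= -cards_eq0 (valP I). Qed.

Lemma sgn_idx_id m p q (I : ksub m p) (J : ksub m q) :
  [disjoint val I & val J] -> sgn_idx I J I J = 1.
Proof.
rewrite -catidx_injectiveb => /injectiveP inj; rewrite /sgn_idx.
case: pickP => [s /forallP Qs|/(_ 1%g)/forallP[a]]; last by rewrite perm1.
suff -> : s = 1%g by rewrite odd_perm1.
by apply/permP => a; apply: inj; rewrite (eqP (Qs a)) perm1.
Qed.

Lemma sum_ksub0 (V : nmodType) m (F : ksub m 0 -> V) : \sum_I F I = F (ksub0 m).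
Proof. by rewrite (big_pred1 (ksub0 m)) // => I; apply/esym/eqP/ksub0P. Qed.

(** For q = 0 the subsets I2, J2 and R are empty, so the operator part is 1, and equality of the
    unions forces J1 = I1 with sign 1. *)
Lemma Fp0 p : Fpq p 0 = ck K n r p.
Proof.
apply: eq_bigr => I _; transitivity (\sum_(J | J == I)
  \det (mxsub (kidx I) (kidx J) (varY K n r))); last by rewrite big_pred1_eq.
rewrite [RHS]big_mkcond; apply: eq_bigr => J _.
rewrite sum_ksub0 big_mkcond sum_ksub0 /= !disjoints_subset setC0 !subsetT !setU0 /=.
rewrite -[X in _ = if X then _ else _]val_eqE [_ == val I]eq_sym.
case: eqP => // /val_inj <-.
rewrite sgn_idx_id; last by rewrite disjoints_subset setC0 subsetT.
rewrite mulr1z sum_ksub0 /determinant.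
rewrite -[RHS]mulr1; congr (_ * _).
have perm0 (s : 'S_0) : s = 1%g by apply/permP => -[].
rewrite !(big_pred1 1%g) ?big_ord0 => [|s|s]; try exact/esym/eqP/perm0.
by rewrite odd_perm1 !mul1r /cst mpolyC1.
Qed.

(** Since M_{p,q+1} = D M_{p+1,q}, the induction on q lets p vary; collecting the terms of
    [KWop_Fpq] gives the recurrence [coefMS]. *)
Lemma Mpq_Fpq p q : (p + q <= n)%N ->
  (Mpq K n r p q : polymap) = \sum_(l < q.+1) Fpq p l *~ coefM n p q l.
Proof.
elim: q p => [|q IH] p le_n.
  rewrite big_ord1 coefMqq -[RHS]/(Fpq p 0) Fp0 /= addn0.
  done.
have -> : (Mpq K n r p q.+1 : polymap) = KWop (Mpq K n r p.+1 q) by rewrite /Mpq addnS.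
rewrite IH; last by rewrite addSnnS.
rewrite raddf_sum.
transitivity (\sum_(l < q.+1) (Fpq p l.+1 *~ (coefM n p.+1 q l * l.+1%:R)
    - Fpq p l *~ (coefM n p.+1 q l * (l * (n - (p + l)))%:R))).
  apply: eq_bigr => l _; rewrite raddfMz /= KWop_Fpq mulrzBl !natz !pmulrn -!mulrzA.
  by rewrite ![_ * coefM _ _ _ _]mulrC.
rewrite sumrB [RHS]big_ord_recl coefM0 mulr0z add0r.
(* The index shifts by one: the term l = 0 vanishes through its factor l, and the added top term l =
   q+1 through [coefM_big]. *)
have -> : \sum_(l < q.+1) Fpq p l *~ (coefM n p.+1 q l * (l * (n - (p + l)))%:R)
   = \sum_(l < q.+1) Fpq p l.+1 *~ (coefM n p.+1 q l.+1 * (l.+1 * (n - (p + l.+1)))%:R).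
  transitivity (\sum_(l < q.+2) Fpq p l *~ (coefM n p.+1 q l * (l * (n - (p + l)))%:R)).
    by rewrite [RHS]big_ord_recr /= coefM_big mul0r mulr0z addr0.
  by rewrite big_ord_recl mul0n mulr0 mulr0z add0r.
rewrite -sumrB; apply: eq_bigr => l _.
by rewrite -mulrzBr coefMS // -ltnS.
Qed.

Lemma subalg_genS (G H : polymap -> Prop) :
  (forall F, G F -> subalg_gen H F) -> forall F, subalg_gen G F -> subalg_gen H F.
Proof.
move=> GH F; elim=> {F} [F /GH//|c|F1 F2 _ H1 _ H2|F1 F2 _ H1 _ H2].
- exact: gen_scal.
- exact: gen_add.
- exact: gen_mul.
Qed.

Lemma subalg_gen_mulrz (G : polymap -> Prop) F z : subalg_gen G F -> subalg_gen G (F *~ z).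
Proof.
move=> GF; rewrite -mulrzl.
have -> : z%:~R = cst z%:~R%:A :> polymap by rewrite scaler_int /cst raddfMz /= mpolyC1.
by apply: gen_mul => //; apply: gen_scal.
Qed.

Lemma subalg_gen_sum (G : polymap -> Prop) (I : finType) (Q : pred I) (F : I -> polymap) :
  (forall i, Q i -> subalg_gen G (F i)) -> subalg_gen G (\sum_(i | Q i) F i).
Proof.
move=> GF; elim/big_ind: _ => //; last exact: gen_add.
by have := gen_scal G 0; rewrite scale0r /cst mpolyC0.
Qed.

Lemma big_algebra_Fpq F :
  big_algebra F <->
  subalg_gen (fun G => exists p q : nat, (p + q <= n)%N /\ G = Fpq p q) F.
Proof.
split; apply: subalg_genS => {}F [p [q [le_n ->]]].
  rewrite Mpq_Fpq //; apply: subalg_gen_sum => l _; apply: subalg_gen_mulrz.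
  by apply: gen_in; exists p, l; split=> //; apply: leq_trans le_n; rewrite leq_add2l -ltnS.
elim/ltn_ind: q le_n => q IH le_n.
(* The formula for M_{p,q} is solved for its top term q! F_{p,q}; the induction hypothesis covers
   the lower terms. *)
have -> : Fpq p q = cst (q`!%:R^-1)%:A
    * ((Mpq K n r p q : polymap) + (\sum_(l < q) Fpq p l *~ coefM n p q l) *~ (-1)).
  rewrite Mpq_Fpq // big_ord_recr /= coefMqq mulrN1z addrAC subrr add0r natz -pmulrn.
  rewrite mulrnAr -mulrnAl /cst -raddfMn /= -scaler_nat scalerA.
  rewrite mulfV ?pnatr_eq0 -?lt0n ?fact_gt0 //.
  by rewrite scale1r mpolyC1 mul1r.
apply: gen_mul; first exact: gen_scal.
apply: gen_add; first by apply: gen_in; exists p, q.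
apply/subalg_gen_mulrz/subalg_gen_sum => l _; apply: subalg_gen_mulrz.
by apply: IH => //; apply: leq_trans le_n; rewrite leq_add2l ltnW.
Qed.

End Generation.

Theorem corollary3p14 (R : realType) (n r : nat) (n_gt0 : (0 < n)%N) (r_gt0 : (0 < r)%N) :
  (forall F : polymap R[i] n r,
     big_algebra F <->
     subalg_gen (fun G => exists p q : nat, (p + q <= n)%N /\ G = Fpq R[i] n r p q) F)
  /\
  (forall p q : nat, (p + q <= n)%N ->
     (Mpq R[i] n r p q : polymap R[i] n r) =
     \sum_(l < q.+1)
       (-1) ^+ (q - l)
       * ((q - l)`! * l`! * stirling2 q l * 'C(n - p - l, q - l))%:R
       * Fpq R[i] n r p l).
Proof.
split=> [F|p q le_n]; first exact: big_algebra_Fpq.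
rewrite Mpq_Fpq //; apply: eq_bigr => l _.
by rewrite -mulrzl /coefM intrM rmorph_sign rmorph_nat.
Qed.
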